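(* Let $\varphi\in L^2(\mathbb{R})$ be such that $\dfrac{1}{\Phi_\varphi}\in L^1(\mathbb{T})$. Then the system $\{\varphi(\cdot+k)\}_{k\in\mathbb{Z}}$ is an $M$-basis in $S(\varphi)$.
   Context: $\mathbb{T}=\mathbb{R}/\mathbb{Z}$. The Fourier transform on $L^2(\mathbb{R})$ is the isometry given for $f\in L^1(\mathbb{R})\cap L^2(\mathbb{R})$ by $\widehat f(y)=\int_{\mathbb{R}}f(x)e^{-2\pi ixy}\,dx$. For $\varphi\in L^2(\mathbb{R})$, $\Phi_\varphi(t)=\sum_{k\in\mathbb{Z}}|\widehat\varphi(t+k)|^2$, a $1$-periodic nonnegative function in $L^1(\mathbb{T})$ ($1/\Phi_\varphi$ is taken to be $+\infty$ where $\Phi_\varphi=0$). $S(\varphi)$ is the closed linear span in $L^2(\mathbb{R})$ of $\{\varphi(\cdot+k):k\in\mathbb{Z}\}$. A system $\{y_k\}$ in a Banach space $B$ is an $M$-basis if it is complete (its linear span is dense in $B$) and minimal (no $y_k$ lies in the closed linear span of the others), and its dual (biorthogonal) system $\{y_k^*\}\subset B^*$, $y_k^*(y_j)=\delta_{jk}$, is total with respect to $B$, i.e. $y_k^*(x)=0$ for all $k$ implies $x=0$. *)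

(* Defs.v *)
From HB Require Import structures.
From mathcomp Require Import all_boot all_order all_algebra.
From mathcomp Require Import generic_quotient ring_quotient.
From mathcomp Require Import all_classical all_reals all_analysis.
From mathcomp Require Import measurable_realfun.

Set Implicit Arguments.
Unset Strict Implicit.
Unset Printing Implicit Defensive.
Import Order.TTheory GRing.Theory Num.Theory.
Import numFieldNormedType.Exports.
From mathcomp Require Import complex.
Import Normc.

Local Open Scope classical_set_scope.
Local Open Scope ring_scope.
Local Open Scope complex_scope.
Local Open Scope quotient_scope.

Section complex_Lp.
Context {R : realType}.
Local Notation mu := (@lebesgue_measure R).
Implicit Types f g : R -> R[i].

Definition cLfun (p : R) : set (R -> R[i]) := [set f : R -> R[i] |
  [/\ measurable_fun [set: R] (fun x => Re (f x)),
      measurable_fun [set: R] (fun x => Im (f x)) &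
      finite_norm mu p%:E (fun x => normc (f x))]].

Definition cLnorm (p : R) f : R :=
  fine ('N[mu]_p%:E[EFin \o (fun x => normc (f x))]).

Lemma measurable_normc f :
  measurable_fun [set: R] (fun x => Re (f x)) ->
  measurable_fun [set: R] (fun x => Im (f x)) ->
  measurable_fun [set: R] (fun x => normc (f x)).
Proof.
move=> mr mi.
rewrite (_ : (fun x => _) =
    @Num.sqrt R \o (fun x => Re (f x) ^+ 2 + Im (f x) ^+ 2)); last first.
  by apply/funext => x /=; case: (f x).
apply: measurableT_comp => //.
  exact: (continuous_measurable_fun (@sqrt_continuous R)).
by apply: measurable_funD; apply: measurable_funX.
Qed.

End complex_Lp.

Section cL2.
Context {R : realType}.
Local Notation mu := (@lebesgue_measure R).
Implicit Types f g : R -> R[i].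

Lemma cL2_finite f : cLfun 2 f ->
  ('N[mu]_2%:E[EFin \o (fun x => normc (f x))] = (cLnorm 2 f)%R%:E)%E.
Proof. by move=> [_ _ ff]; rewrite fineK// ge0_fin_numE ?Lnorm_ge0. Qed.

Lemma measurable_cL2 f :
  cLfun 2 f -> measurable_fun [set: R] (fun x => normc (f x)).
Proof. by case=> ? ? _; exact: measurable_normc. Qed.

Lemma le_Lnorm2 (u v : R -> R) :
  measurable_fun [set: R] u -> measurable_fun [set: R] v ->
  (forall x, `|u x| <= `|v x|) ->
  ('N[mu]_2%:E[EFin \o u] <= 'N[mu]_2%:E[EFin \o v])%E.
Proof.
move=> mu_ mv uv; rewrite unlock; apply: gt0_ler_poweR => //.
- by rewrite in_itv/= leey integral_ge0.
- by rewrite in_itv/= leey integral_ge0.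
apply: ge0_le_integral => //=.
- apply/measurable_EFinP.
  by apply/(@measurableT_comp _ _ _ _ _ _ (fun x : R => x `^ 2)) => //;
    exact/measurableT_comp.
- apply/measurable_EFinP.
  by apply/(@measurableT_comp _ _ _ _ _ _ (fun x : R => x `^ 2)) => //;
    exact/measurableT_comp.
- by move=> x _; rewrite lee_fin ge0_ler_powR ?nnegrE.
Qed.

Lemma Re_add (a b : R[i]) : Re (a + b) = Re a + Re b.
Proof. by case: a b => ? ? [? ?]. Qed.
Lemma Im_add (a b : R[i]) : Im (a + b) = Im a + Im b.
Proof. by case: a b => ? ? [? ?]. Qed.
Lemma Re_mul (a b : R[i]) : Re (a * b) = Re a * Re b - Im a * Im b.
Proof. by case: a b => ? ? [? ?]. Qed.
Lemma Im_mul (a b : R[i]) : Im (a * b) = Re a * Im b + Im a * Re b.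
Proof. by case: a b => ? ? [? ?]. Qed.

Lemma normc_ge0r (a : R[i]) : 0 <= normc a.
Proof. by case: a => a b; exact: sqrtr_ge0. Qed.

Lemma cLnormD2 f g : cLfun 2 f -> cLfun 2 g ->
  ('N[mu]_2%:E[EFin \o (fun x => normc (f x + g x)%R)] <=
   (cLnorm 2 f + cLnorm 2 g)%R%:E)%E.
Proof.
move=> Lf Lg. rewrite [leRHS]EFinD -(cL2_finite Lf) -(cL2_finite Lg).
have mf := measurable_cL2 Lf; have mg := measurable_cL2 Lg.
apply: (le_trans _ (eminkowski mu mf mg _)); last by rewrite lee1n.
apply: le_Lnorm2 => [| |x].
- case: Lf Lg => mrf mif _ [mrg mig _].
  apply: (@measurable_normc _ (fun x => f x + g x)).
  + by under eq_fun do rewrite Re_add; exact: measurable_funD.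
  + by under eq_fun do rewrite Im_add; exact: measurable_funD.
- exact: measurable_funD.
- rewrite !ger0_norm ?addr_ge0 ?normc_ge0r//.
  exact: le_normcD.
Qed.

Lemma cLnormZ2 (a : R[i]) f : cLfun 2 f ->
  ('N[mu]_2%:E[EFin \o (fun x => normc (a * f x)%R)] =
   (normc a * cLnorm 2 f)%R%:E)%E.
Proof.
move=> Lf; rewrite [RHS]EFinM -(cL2_finite Lf).
have mf := measurable_cL2 Lf.
have LLf : (fun x => normc (f x)) \in Lfun mu 2%:E.
  by rewrite inE; apply/andP; split; rewrite inE//=; case: Lf.
have := @LnormZ _ _ _ mu _ (lee1n 2) (Lfun_Sub (lee1n 2) LLf) (normc a).
rewrite ger0_norm ?normc_ge0r//= => <-.
by apply: eq_Lnorm => x /=; rewrite normcM.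
Qed.

Lemma cL2_submod : submod_closed (mem (@cLfun R 2)).
Proof.
split.
  rewrite inE; split; [exact: measurable_cst..|].
  rewrite /finite_norm (_ : _ \o _ = cst 0%E) ?Lnorm0//.
  by apply/funext => x; congr EFin; exact: normc0.
move=> a f g /[!inE] Lf Lg.
case: (Lf) => mrf mif _; case: (Lg) => mrg mig _.
have Laf : cLfun 2 (fun x => a * f x).
  split.
  - by under eq_fun do rewrite Re_mul; apply: measurable_funB;
      apply: measurable_funM.
  - by under eq_fun do rewrite Im_mul; apply: measurable_funD;
      apply: measurable_funM.
  - by rewrite /finite_norm cLnormZ2// ltry.
split.
- by under eq_fun do rewrite Re_add Re_mul; apply: measurable_funD => //;
    apply: measurable_funB; apply: measurable_funM.
- by under eq_fun do rewrite Im_add Im_mul; apply: measurable_funD => //;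
    apply: measurable_funD; apply: measurable_funM.
- by rewrite /finite_norm (le_lt_trans (cLnormD2 Laf Lg))// ltry.
Qed.

End cL2.

Section L2_def.
Variable R : realType.
Local Notation mu := (@lebesgue_measure R).

Definition cL2pred : {pred (R -> R[i])} := mem (@cLfun R 2).
HB.instance Definition _ :=
  GRing.isSubmodClosed.Build _ _ cL2pred (@cL2_submod R).

Record cL2fun := CL2fun { cL2fun_val :> R -> R[i]; _ : cL2fun_val \in cL2pred }.

HB.instance Definition _ := [isSub for cL2fun_val].
HB.instance Definition _ := [Choice of cL2fun by <:].
HB.instance Definition _ := [SubChoice_isSubLmodule of cL2fun by <:].

(* Functions are Borel measurable; every Lebesgue measurable class has a Borel
   representative, so the quotient below is the usual L^2(R). *)
Definition cL2null : {pred cL2fun} :=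
  mem [set f : cL2fun | {ae mu, forall x, f x = 0}].

Lemma cL2null_zmod : zmod_closed cL2null.
Proof.
split; first by rewrite inE; apply: aeW.
move=> f g /[!inE]; apply: (filterS2 (ae_filter_ringOfSetsType mu)) => x fx0 gx0.
by change (f x - g x = 0); rewrite fx0 gx0 subr0.
Qed.

HB.instance Definition _ := GRing.isZmodClosed.Build _ cL2null cL2null_zmod.

Definition L2 : Type := @Quotient.quot cL2fun cL2null.
HB.instance Definition _ := GRing.Zmodule.on L2.
HB.instance Definition _ := EqQuotient.on L2.

End L2_def.

Section L2_structure.
Variable R : realType.
Local Notation mu := (@lebesgue_measure R).
Implicit Types (f g : cL2fun R) (u v : L2 R) (a b : R[i]).

Lemma cL2funP f : cLfun 2 f.
Proof. by have := valP f; rewrite inE. Qed.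

Lemma eqL2P f g :
  (\pi_(L2 R) f = \pi_(L2 R) g) <-> {ae mu, forall x, f x = g x}.
Proof.
have -> : (\pi_(L2 R) f = \pi_(L2 R) g) <-> f - g \in @cL2null R.
  rewrite Quotient.idealrBE; split => [->//|/eqP//].
rewrite inE; split=> fg;
  apply: (@filterS _ _ (ae_filter_ringOfSetsType mu) _ _ _ fg) => x.
  by move=> fg0; apply/eqP; rewrite -subr_eq0; apply/eqP.
by move=> fgx; change (f x - g x = 0); rewrite fgx subrr.
Qed.

Definition L2scale a u : L2 R := \pi_(L2 R) (a *: repr u).

Lemma pi_L2scale a f : L2scale a (\pi_(L2 R) f) = \pi_(L2 R) (a *: f).
Proof.
apply/eqL2P; have /eqL2P ff := reprK (\pi_(L2 R) f).
apply: (@filterS _ _ (ae_filter_ringOfSetsType mu) _ _ _ ff) => x fx.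
by change (a * repr (\pi_(L2 R) f) x = a * f x); rewrite fx.
Qed.

Lemma L2scaleA a b u : L2scale a (L2scale b u) = L2scale (a * b) u.
Proof. elim/quotW: u => f. by rewrite (pi_L2scale b f) !pi_L2scale scalerA. Qed.

Lemma L2scale1 : left_id 1 L2scale.
Proof. by elim/quotW=> f; rewrite pi_L2scale scale1r. Qed.

Lemma L2scaleDr : right_distributive L2scale +%R.
Proof.
move=> a; elim/quotW=> f; elim/quotW=> g.
by rewrite -[X in L2scale _ X]raddfD (pi_L2scale a (f + g)) (pi_L2scale a f)
  (pi_L2scale a g) scalerDr raddfD.
Qed.

Lemma L2scaleDl u : {morph L2scale^~ u : a b / a + b}.
Proof. by move=> a b; elim/quotW: u => f; rewrite !pi_L2scale scalerDl raddfD. Qed.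

HB.instance Definition _ := GRing.Zmodule_isLmodule.Build R[i] (L2 R)
  L2scaleA L2scale1 L2scaleDr L2scaleDl.

Lemma piL2Z a f : a *: \pi_(L2 R) f = \pi_(L2 R) (a *: f).
Proof. exact: pi_L2scale. Qed.

Lemma piL2D f g : \pi_(L2 R) f + \pi_(L2 R) g = \pi_(L2 R) (f + g).
Proof. by rewrite raddfD. Qed.

Lemma ae_cLnorm f g : {ae mu, forall x, f x = g x} -> cLnorm 2 f = cLnorm 2 g.
Proof.
move=> fg; rewrite /cLnorm unlock; congr (fine (_ `^ _)).
have mp h : measurable_fun [set: R] (fun x => (`|normc (cL2fun_val h x)| `^ 2)%:E).
  apply/measurable_EFinP.
  apply/(@measurableT_comp _ _ _ _ _ _ (fun x : R => x `^ 2)) => //.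
  by apply/measurableT_comp => //; apply: measurable_cL2; exact: cL2funP.
apply: ae_eq_integral => //=; try exact: mp.
by apply: (@filterS _ _ (ae_filter_ringOfSetsType mu) _ _ _ fg) => x + _ => ->.
Qed.

Definition L2norm u : R[i] := (cLnorm 2 (repr u))%:C.

Lemma L2norm_pi f : L2norm (\pi_(L2 R) f) = (cLnorm 2 f)%:C.
Proof. by congr _%:C; apply/ae_cLnorm/eqL2P; rewrite reprK. Qed.

Lemma L2normD u v : L2norm (u + v) <= L2norm u + L2norm v.
Proof.
elim/quotW: u => f; elim/quotW: v => g; rewrite piL2D !L2norm_pi -rmorphD /= lecR.
rewrite -lee_fin -(cL2_finite (cL2funP (f + g))).
by apply: cLnormD2; exact: cL2funP.
Qed.

Lemma L2normZ a u : L2norm (a *: u) = `|a| * L2norm u.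
Proof.
elim/quotW: u => f; rewrite piL2Z !L2norm_pi normc_def.
have -> : Num.sqrt (Re a ^+ 2 + Im a ^+ 2) = normc a by case: a.
rewrite -rmorphM /=; congr _%:C; apply: EFin_inj.
rewrite -(cL2_finite (cL2funP (a *: f))).
by rewrite -cLnormZ2//; exact: cL2funP.
Qed.

Lemma L2norm_eq0 u : L2norm u = 0 -> u = 0.
Proof.
elim/quotW: u => f; rewrite L2norm_pi => /(congr1 (@complex.Re R)) /= f0.
have {f0} := congr1 EFin f0.
rewrite -(cL2_finite (cL2funP f)).
move=> f0; rewrite -[RHS](raddf0 (\pi_(L2 R))); apply/eqL2P.
have H : EFin \o (fun x => normc (f x)) = \0%E %[ae mu].
  apply: (Lnorm_eq0_eq0 _ _ f0); last by rewrite lte_fin ltr0n.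
  by apply/measurable_EFinP; apply: measurable_cL2; exact: cL2funP.
apply: (@filterS _ _ (ae_filter_ringOfSetsType mu) _ _ _ H) => x /= /(_ I) [].
by move=> /eq0_normc.
Qed.

HB.instance Definition _ := @Lmodule_isNormed.Build R[i] (L2 R)
  L2norm L2normD L2normZ L2norm_eq0.

End L2_structure.

Section closed_span.
Variables (K : numFieldType) (V : normedModType K).
Implicit Type A : set V.

Definition lin_span A : set V := [set x | exists s : seq (K * V),
  (forall p, p \in s -> A p.2) /\ x = \sum_(p <- s) p.1 *: p.2].

Definition closed_span A : set V := closure (lin_span A).

Lemma sub_closed_span A : A `<=` closed_span A.
Proof.
move=> x Ax; apply: subset_closure; exists [:: (1, x)]; split.
  by move=> p; rewrite inE => /eqP ->.
by rewrite big_seq1 scale1r.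
Qed.

Lemma lin_span_lin A a x y :
  lin_span A x -> lin_span A y -> lin_span A (a *: x + y).
Proof.
move=> [s [sA ->]] [t [tA ->]].
exists ([seq (a * p.1, p.2) | p <- s] ++ t); split.
  by move=> p; rewrite mem_cat => /orP[/mapP[q qs ->]|]; [exact: sA q qs|exact: tA].
rewrite big_cat big_map scaler_sumr; congr (_ + _).
by apply: eq_bigr => p _; rewrite scalerA.
Qed.

Lemma closed_span_submod A : submod_closed (mem (closed_span A)).
Proof.
split.
  rewrite inE; apply: subset_closure; exists [::]; split => //.
  by rewrite big_nil.
move=> a x y /[!inE] Ax Ay U Ux.
have cf : continuous (fun p : V * V => a *: p.1 + p.2).
  move=> p; apply: cvgD; last exact: cvg_snd.
  by apply: cvgZr; exact: cvg_fst.
have [[B C] [/= Bx Cy] BCU] := cf (x, y) U Ux.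
have [x' [Ax' Bx']] := Ax _ Bx; have [y' [Ay' Cy']] := Ay _ Cy.
exists (a *: x' + y'); split; first exact: lin_span_lin.
exact: (BCU (x', y')).
Qed.

Section clspan_type.
Variable A : set V.

Definition clspan_pred : {pred V} := mem (closed_span A).
HB.instance Definition _ :=
  GRing.isSubmodClosed.Build _ _ clspan_pred (closed_span_submod A).

Record clspan := ClSpan { clspan_val :> V; _ : clspan_val \in clspan_pred }.

HB.instance Definition _ := [isSub for clspan_val].
HB.instance Definition _ := [Choice of clspan by <:].
HB.instance Definition _ := [SubChoice_isSubLmodule of clspan by <:].

Lemma clspan_normD (x y : clspan) : `|val (x + y)| <= `|val x| + `|val y|.
Proof. by rewrite raddfD; exact: ler_normD. Qed.
Lemma clspan_normZ a (x : clspan) : `|val (a *: x)| = `|a| * `|val x|.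
Proof. by rewrite linearZ; exact: normrZ. Qed.
Lemma clspan_norm0 (x : clspan) : `|val x| = 0 -> x = 0.
Proof. by move/normr0_eq0 => x0; apply: val_inj. Qed.

HB.instance Definition _ := @Lmodule_isNormed.Build K clspan
  (fun x => `|val x|) clspan_normD clspan_normZ clspan_norm0.

Definition clspan_of (x : V) (Ax : A x) : clspan :=
  ClSpan (mem_set (sub_closed_span Ax)).

End clspan_type.

End closed_span.

Section M_basis.
Variables (K : numFieldType) (B : normedModType K) (I : eqType).
Implicit Type y : I -> B.

(* Completeness of B plays no role in the definitions below. *)
Definition complete_system y := closed_span (range y) = [set: B].

Definition minimal_system y :=
  forall k, ~ closed_span (y @` [set j | j != k]) (y k).

Definition dual_system y (ystar : I -> {linear B -> K^o}) :=
  (forall k, continuous (ystar k)) /\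
  (forall j k, ystar k (y j) = (j == k)%:R).

Definition total_system (ystar : I -> {linear B -> K^o}) :=
  forall x, (forall k, ystar k x = 0) -> x = 0.

Definition M_basis y := [/\ complete_system y, minimal_system y &
  exists2 ystar, dual_system y ystar & total_system ystar].

End M_basis.

Section translation.
Variable R : realType.
Local Notation mu := (@lebesgue_measure R).

Lemma measurable_addr (a : R) : measurable_fun [set: measurableTypeR R]
  (fun x : measurableTypeR R => (x : R) + a : measurableTypeR R).
Proof. exact: measurable_funD. Qed.

Lemma lebesgue_translation (a : R) (A : set R) : measurable A ->
  mu ((fun x : R => x + a) @^-1` A) = mu A.
Proof.
move=> mA.
pose tr : {mfun measurableTypeR R >-> measurableTypeR R} :=
  HB.pack (fun x : measurableTypeR R => (x : R) + a : measurableTypeR R)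
    (isMeasurableFun.Build _ _ _ _ _ (measurable_addr a)).
apply/esym; apply: (@lebesgue_measure_unique R (pushforward mu tr)) => //.
move=> _ [[b c] _ <-].
rewrite /pushforward.
rewrite [X in _ = lebesgue_measure X](_ : _ = `]b - a, c - a]%classic); last first.
  by apply/seteqP; split => x /=; rewrite !in_itv/= ltrBlDr lerBrDr.
rewrite !lebesgue_measure_itv/= !lte_fin ltrD2r; case: ifP => // _.
by rewrite -!EFinB; congr EFin; rewrite opprB addrA subrK.
Qed.

Lemma ae_translation (a : R) (P : R -> Prop) :
  {ae mu, forall x, P x} -> {ae mu, forall x, P (x + a)}.
Proof.
move=> [N [mN N0 PN]].
exists ((fun x : R => x + a) @^-1` N); split.
- by rewrite -[X in measurable X]setTI; exact: measurable_addr.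
- by rewrite lebesgue_translation.
- by move=> x /= nPx; apply: PN.
Qed.

Lemma ge0_integral_translation (a : R) (u : R -> \bar R) :
  measurable_fun [set: R] u -> (forall x, (0 <= u x)%E) ->
  (\int[mu]_x u (x + a)%R = \int[mu]_x u x)%E.
Proof.
move=> mmu u0.
have := ge0_integral_pushforward (measurable_addr a) mu (D := setT)
  measurableT mmu (fun x _ => u0 x).
rewrite preimage_setT /= => <-.
apply: eq_measure_integral; first exact: measurable_addr.
by move=> ? A mA _; exact: lebesgue_translation.
Qed.

Lemma cL2_translate (f : cL2fun R) (a : R) :
  (fun x : R => f (x + a)) \in @cL2pred R.
Proof.
rewrite inE; have [mr mi] := cL2funP f; rewrite /finite_norm unlock => nf.
split.
- exact: (measurableT_comp mr (measurable_addr a)).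
- exact: (measurableT_comp mi (measurable_addr a)).
- rewrite /finite_norm unlock.
  rewrite (ge0_integral_translation a
    (u := fun x => (`|EFin (normc (f x))| `^ 2)%E)) => //; last first.
    by move=> x; exact: poweR_ge0.
  apply/measurable_EFinP.
  apply/(@measurableT_comp _ _ _ _ _ _ (fun x : R => x `^ 2)) => //.
  by apply/measurableT_comp => //; apply: measurable_cL2; exact: cL2funP.
Qed.

(* Independent of the representative by translate_pi. *)
Definition translate (a : R) (u : L2 R) : L2 R :=
  \pi_(L2 R) (CL2fun (cL2_translate (repr u) a)).

Lemma translate_pi (a : R) (f : cL2fun R) :
  translate a (\pi_(L2 R) f) = \pi_(L2 R) (CL2fun (cL2_translate f a)).
Proof.
apply/eqL2P; have /eqL2P ff := reprK (\pi_(L2 R) f).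
exact: (ae_translation a ff).
Qed.

End translation.

Section fourier.
Variable R : realType.
Local Notation mu := (@lebesgue_measure R).

(* A representative of the class, determined up to a null set. *)
Definition L2_to_fun (u : L2 R) : R -> R[i] := cL2fun_val (repr u).

Definition expi (t : R) : R[i] := cos t +i* sin t.

Definition cintegral (g : R -> R[i]) : R[i] :=
  (\int[mu]_x Re (g x)) +i* (\int[mu]_x Im (g x)).

Definition fourier_integral (f : R -> R[i]) (y : R) : R[i] :=
  cintegral (fun x => f x * expi (- (2 * pi * x * y))).

(* By density of L^1 \cap L^2 and Plancherel's theorem there is exactly one
   such F. *)
Definition is_fourier_transform (F : {linear L2 R -> L2 R}) : Prop :=
  (forall u, `|F u| = `|u|) /\
  (forall f : cL2fun R, cLfun 1 f ->
    {ae mu, forall y,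
      L2_to_fun (F (\pi_(L2 R) f)) y = fourier_integral f y}).

(* Extended-real valued, so that its inverse (with 0^-1 = +oo and +oo^-1 = 0 in
   ereal_scope) is defined everywhere. *)
Definition Phi (F : {linear L2 R -> L2 R}) (phi : L2 R) (t : R) : \bar R :=
  \esum_(k in [set: int]) (normc (L2_to_fun (F phi) (t + k%:~R)) ^+ 2)%:E.

Definition shifts (phi : L2 R) (k : int) : L2 R := translate k%:~R phi.

Definition shift_span (phi : L2 R) := clspan (range (shifts phi)).

Definition shift_system (phi : L2 R) (k : int) : shift_span phi :=
  clspan_of (imageT (shifts phi) k).

End fourier.

(* Main.v *)
(** Write g for the Fourier transform of phi.  The Fourier transform turns the
    translate phi(. + k) into e_k g with e_k(x) = exp(2 i pi k x), so that
    everything can be read off periodizations over [0, 1[.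
    The dual functionals are u |-> \int F u * conj(g) / Phi * e_{-k}.  They are
    bounded because \int |g|^2 / Phi^2 = \int_[0, 1[ 1 / Phi, and biorthogonal
    because |g|^2 / Phi periodizes to 1; minimality follows.
    For totality, if all these functionals vanish at u, the periodization of
    F u * conj(g) / Phi is an integrable function on [0, 1[ all of whose Fourier
    coefficients vanish, hence it is zero almost everywhere.  Multiplying by the
    periodic function Phi, F u is orthogonal to every e_k g, hence to the whole
    image of S(phi), hence to itself. *)
From HB Require Import structures.
Require Import Defs.
From mathcomp Require Import all_boot all_order all_algebra.
From mathcomp Require Import generic_quotient.
From mathcomp Require Import all_classical all_reals all_analysis.
From mathcomp Require Import measurable_realfun.
From mathcomp Require Import ring lra.

Set Implicit Arguments.
Unset Strict Implicit.
Unset Printing Implicit Defensive.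
Import Order.TTheory GRing.Theory Num.Theory.
Import numFieldNormedType.Exports.
From mathcomp Require Import complex.
Import Normc.

Local Open Scope classical_set_scope.
Local Open Scope ring_scope.
Local Open Scope complex_scope.

(** * Periodization of nonnegative functions *)

Section periodization.
Variable R : realType.
Local Notation mu := (@lebesgue_measure R).
Local Open Scope ereal_scope.

(** The periodization of F u * conj(g) / Phi is only known to be integrable, so Parseval's identity
    cannot give its vanishing. Uniqueness is proved directly for integrable real functions:
    polynomials in one trigonometric polynomial of degree 1 yield, by dominated convergence,
    vanishing integrals over every ]0, b[, and Lebesgue differentiation concludes. Multiplying by
    Phi is delicate because Phi may be unbounded. Orthogonality is therefore stated for every
    periodic weight whose product with the function is integrable; here the product is F u *
    conj(g), integrable by Cauchy-Schwarz. Integrability of 1 / Phi acts twice: it puts conj(g) /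
    Phi in L2, and it makes Phi nonzero almost everywhere, so that dividing by Phi and multiplying
    back loses nothing. The rule for translates comes from a substitution in the Fourier integral,
    hence for integrable functions only; truncation extends it to L2, both sides being isometric in
    u. *)

Definition int_of_nat (n : nat) : int := if odd n then Negz n./2 else Posz n./2.

Lemma int_of_nat_bij : set_bij [set: nat] [set: int] int_of_nat.
Proof.
split => //.
- move=> m n _ _; rewrite /int_of_nat.
  by case: ifP => om; case: ifP => on // [mn];
    rewrite -(odd_double_half m) -(odd_double_half n) mn om on.
- move=> [n|n] _; [exists n.*2|exists n.*2.+1] => //; rewrite /int_of_nat.
    by rewrite odd_double doubleK.
  by rewrite /= odd_double /= uphalf_double.
Qed.

(** Turns sums over the integers into series, to which measurability and term-by-term integration
    apply. *)
Lemma int_esumE (a : int -> \bar R) : (forall k, 0 <= a k) ->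
  \esum_(k in [set: int]) a k = \sum_(n <oo) a (int_of_nat n).
Proof. by move=> a0; rewrite (reindex_esum _ _ _ _ int_of_nat_bij) nneseries_esumT. Qed.

Lemma measurable_int_esum (f : int -> R -> \bar R) :
  (forall k, measurable_fun [set: R] (f k)) -> (forall k x, 0 <= f k x) ->
  measurable_fun [set: R] (fun t => \esum_(k in [set: int]) f k t).
Proof.
move=> mf f0; under eq_fun do rewrite int_esumE//.
exact: ge0_emeasurable_sum.
Qed.

Lemma esum_translation (f : R -> \bar R) (t : R) (m : int) :
  \esum_(k in [set: int]) f (t + m%:~R + k%:~R)%R =
  \esum_(k in [set: int]) f (t + k%:~R)%R.
Proof.
rewrite [RHS](@reindex_esum _ _ _ [set: int] _ (fun k => m + k)%R).
  by apply: eq_esum => k _; rewrite intrD addrA.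
by split.
Qed.

(** The line is the disjoint union of the intervals [k, k + 1[; each is translated to [0, 1[, and
    nonnegativity permits exchanging sum and integral. *)
Lemma ge0_integral_periodization (f : R -> \bar R) :
  measurable_fun [set: R] f -> (forall x, 0 <= f x) ->
  \int[mu]_x f x =
  \int[mu]_(t in `[0%R, 1%R[) \esum_(k in [set: int]) f (t + k%:~R)%R.
Proof.
move=> mf f0.
pose E n := `[(int_of_nat n)%:~R : R, (int_of_nat n)%:~R + 1[%classic%R.
have [_ _ es] := int_of_nat_bij.
have ET : \bigcup_n E n = [set: R].
  apply/seteqP; split => // x _; have [n _ en] := es (Num.floor x) I.
  by exists n => //=; rewrite /E en /= in_itv/= -[1%R]/(1%:~R) -intrD; exact: floor_itv.
have Etriv : trivIset setT E.
  move=> i j _ _ [x []]; rewrite /E /= !in_itv/= -[1%R]/(1%:~R) -!intrD.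
  move=> /floor_def xi /floor_def xj; have [_ + _] := int_of_nat_bij; apply; rewrite ?inE//.
  by rewrite -xi.
have mE n : measurable (E n) by exact: measurable_itv.
have mfk (k : int) : measurable_fun [set: R] (fun t : R => f (t + k%:~R)%R).
  exact: (measurableT_comp mf (measurable_addr _)).
rewrite -ET ge0_integral_bigcup// ?ET//.
under [RHS]eq_integral do rewrite int_esumE//.
rewrite integral_nneseries//; last by move=> n; exact: (measurable_funTS (mfk _)).
apply: eq_eseriesr => n _.
(* Translation invariance concerns integrals over the whole line, so both domains are first moved
   into the integrand. *)
rewrite integral_mkcond [RHS]integral_mkcond.
rewrite -[LHS](ge0_integral_translation (int_of_nat n)%:~R); last 2 first.
- by apply/(measurable_restrictT _ _).1 => //; exact: measurable_funTS.
- by move=> x; apply: erestrict_ge0.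
apply: eq_integral => x _; rewrite !patchE.
congr (if _ then _ else _); apply/idP/idP; rewrite !inE /E/= !in_itv/=.
  by rewrite lerDr addrC ltrD2l.
by rewrite lerDr [(x + _)%R]addrC ltrD2l.
Qed.

(** The indicator of the exceptional set is integrated by periodization: off the null set, a point
    of [0, 1[ satisfies [P] together with all its integer translates, so the sum is 0 there. *)
Lemma ae_periodic (P : R -> Prop) : measurable [set x | P x] ->
  (forall x (k : int), P x -> P (x + k%:~R)%R) ->
  {ae mu, forall x, `[0%R, 1%R[%classic x -> P x} -> {ae mu, forall x, P x}.
Proof.
move=> mP per [N [mN N0 PN]].
exists (~` [set x | P x]); split => //; first exact: measurableC.
have m1 : measurable_fun [set: R] (\1_(~` [set x | P x]) : R -> R).
  by apply: measurable_indic; exact: measurableC.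
rewrite -[X in mu X]setIT -integral_indic//; last exact: measurableC.
rewrite ge0_integral_periodization//; last first.
  exact/measurable_EFinP.
rewrite -[RHS](integral0 mu `[0%R, 1%R[).
apply: ge0_ae_eq_integral => //.
- apply: measurable_funTS; apply: measurable_int_esum => // k.
  apply/measurable_EFinP; exact: (measurableT_comp m1 (measurable_addr _)).
- by move=> x _; apply: esum_ge0.
exists N; split => // x /= nx; apply: PN => /= Px; apply: nx => x01.
rewrite esum1// => k _; rewrite indicE memNset//= => nP; apply: nP.
by apply: per; exact: Px.
Qed.
End periodization.
(** * Integrable functions with vanishing Fourier coefficients *)

Section step_polynomials.
Variable R : realType.

Lemma bernoulli_ineq (y : R) (m : nat) : -1 <= y -> 1 + m%:R * y <= (1 + y) ^+ m.
Proof.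
move=> y1; elim: m => [|m ih]; first by rewrite mul0r addr0 expr0.
rewrite exprS; apply: (@le_trans _ _ ((1 + y) * (1 + m%:R * y))).
  by rewrite -[m.+1%:R]natr1; have := sqr_ge0 y; have := ler0n R m; nra.
by apply: ler_wpM2l ih; lra.
Qed.

(* By Bernoulli's inequality these polynomials approximate, boundedly and
   pointwise off 1/2, the indicator of [0, 1/2[ on [0, 1]. *)
Definition step_poly (n : nat) : {poly R} := (1 - 'X^n) ^+ (2 ^ n).

Lemma step_polyE n x : (step_poly n).[x] = (1 - x ^+ n) ^+ (2 ^ n).
Proof. by rewrite horner_exp !hornerE. Qed.

Lemma step_poly01 n x : 0 <= x <= 1 -> 0 <= (step_poly n).[x] <= 1.
Proof.
move=> /andP[x0 x1]; rewrite step_polyE.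
have xn0 : 0 <= x ^+ n by rewrite exprn_ge0.
have xn1 : x ^+ n <= 1 by rewrite exprn_ile1.
by rewrite exprn_ge0 ?subr_ge0// exprn_ile1// ?subr_ge0// lerBlDr lerDl.
Qed.

(** Bernoulli's inequality at -x^n bounds the polynomial below by 1 - (2x)^n. *)
Lemma step_poly_cvg1 x : 0 <= x < 2^-1 -> (step_poly n).[x] @[n --> \oo] --> (1 : R).
Proof.
move=> /andP[x0 x1].
apply: (@squeeze_cvgr _ _ _ _ (fun n => 1 - (2 * x) ^+ n) (cst 1)); last 2 first.
- rewrite -[X in _ --> X]subr0; apply: cvgB; first exact: cvg_cst.
  by apply: cvg_expr; rewrite ger0_norm; lra.
- exact: cvg_cst.
apply: nearW => n; have x01 : 0 <= x <= 1 by lra.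
have /andP[_ ->] := step_poly01 n x01; rewrite andbT step_polyE.
have := @bernoulli_ineq (- x ^+ n) (2 ^ n); rewrite natrX mulrN exprMn; apply.
by rewrite lerN2 exprn_ile1//; lra.
Qed.

(** By Bernoulli (2x)^n <= (1 + x^n)^(2^n), so the polynomial times (2x)^n is at most (1 -
    x^(2n))^(2^n) <= 1. *)
Lemma step_poly_cvg0 x : 2^-1 < x <= 1 -> (step_poly n).[x] @[n --> \oo] --> (0 : R).
Proof.
move=> /andP[x1 x2].
apply: (@squeeze_cvgr _ _ _ _ (cst 0) (fun n => (2 * x)^-1 ^+ n)); last 2 first.
- exact: cvg_cst.
- apply: cvg_expr; rewrite ger0_norm ?invr_ge0; last by lra.
  by rewrite invf_lt1; lra.
apply: nearW => n; have x01 : 0 <= x <= 1 by lra.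
have /andP[-> _] := step_poly01 n x01; rewrite step_polyE/=.
have x0 : 0 < 2 * x by lra.
have xn0 : 0 <= x ^+ n by rewrite exprn_ge0//; lra.
have xn1 : x ^+ n <= 1 by rewrite exprn_ile1//; lra.
rewrite exprVn -div1r ler_pdivlMr ?exprn_gt0//.
apply: (@le_trans _ _ ((1 - x ^+ n) ^+ (2 ^ n) * (1 + x ^+ n) ^+ (2 ^ n))).
  apply: ler_wpM2l; first by rewrite exprn_ge0// subr_ge0.
  have := @bernoulli_ineq (x ^+ n) (2 ^ n); rewrite natrX -exprMn => /(_ _).
  by move=> h; apply: le_trans (h _); lra.
rewrite -exprMn exprn_ile1//; last by nra.
by apply: mulr_ge0; lra.
Qed.
End step_polynomials.
Section fourier_uniqueness.
Variable R : realType.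
Local Notation mu := (@lebesgue_measure R).
Local Notation D := (`[0, 1[%classic : set R).

(** Integrability is part of the property so that it is stable under linear combinations. *)
Definition null_integral (f : R -> R) :=
  mu.-integrable D (EFin \o f) /\ \int[mu]_(t in D) f t = 0.

Lemma null_integralD f g : null_integral f -> null_integral g ->
  null_integral (fun t => f t + g t).
Proof.
move=> [fi f0] [gi g0]; split; last by rewrite RintegralD// f0 g0 addr0.
rewrite (_ : _ \o _ = (EFin \o f) \+ (EFin \o g))%E; last exact/funext.
exact: integrableD.
Qed.

Lemma null_integralZ a f : null_integral f -> null_integral (fun t => a * f t).
Proof.
move=> [fi f0]; split; last by rewrite RintegralZl// f0 mulr0.
rewrite (_ : _ \o _ = (fun t => a%:E * (EFin \o f) t))%E; last exact/funext.
exact: integrableZl.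
Qed.

Definition cosk (k : int) (t : R) := cos (2 * pi * k%:~R * t).
Definition sink (k : int) (t : R) := sin (2 * pi * k%:~R * t).

Lemma coskD k m t : cosk (k + m) t = cosk k t * cosk m t - sink k t * sink m t.
Proof. by rewrite /cosk intrD mulrDr mulrDl cosD. Qed.

Lemma sinkD k m t : sink (k + m) t = sink k t * cosk m t + cosk k t * sink m t.
Proof. by rewrite /sink intrD mulrDr mulrDl sinD. Qed.

Lemma coskN k t : cosk (- k) t = cosk k t.
Proof. by rewrite /cosk intrN mulrN mulNr cosN. Qed.

Lemma sinkN k t : sink (- k) t = - sink k t.
Proof. by rewrite /sink intrN mulrN mulNr sinN. Qed.

(** Multiplication by a trigonometric polynomial of degree 1 sends frequency k to k - 1, k and k +
    1. The induction on [p] closes because the claim covers all k, cosines and sines at once. *)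
Lemma null_integral_trig_poly (h : R -> R) (a b c : R) (p : {poly R}) :
  (forall k, null_integral (fun t => h t * cosk k t)) ->
  (forall k, null_integral (fun t => h t * sink k t)) ->
  forall k,
  null_integral (fun t => h t * p.[a + b * cosk 1 t + c * sink 1 t] * cosk k t) /\
  null_integral (fun t => h t * p.[a + b * cosk 1 t + c * sink 1 t] * sink k t).
Proof.
move=> hc hs; pose x t := a + b * cosk 1 t + c * sink 1 t.
elim/poly_ind: p => [|p d ih] k.
  have z : null_integral (fun t => 0 * (h t * cosk 0 t)) by exact: null_integralZ.
  by split; congr null_integral: z; apply/funext => t; rewrite horner0 mulr0 !mul0r.
have ihc m := (ih m).1; have ihs m := (ih m).2.
split.
(* Product-to-sum formulas: cos and sin of frequency 1 times [cosk k] split into halves at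
   frequencies k + 1 and k - 1. *)
- have e : null_integral (fun t => a * (h t * p.[x t] * cosk k t)
    + (b / 2 * (h t * p.[x t] * cosk (k + 1) t)
       + b / 2 * (h t * p.[x t] * cosk (k - 1) t))
    + (c / 2 * (h t * p.[x t] * sink (k + 1) t)
       + - (c / 2) * (h t * p.[x t] * sink (k - 1) t))
    + d * (h t * cosk k t)).
    by repeat apply: null_integralD; apply: null_integralZ.
  congr null_integral: e; apply/funext => t.
  by rewrite hornerMXaddC -/(x t) !(coskD, sinkD) !(coskN, sinkN) /x; field.
- have e : null_integral (fun t => a * (h t * p.[x t] * sink k t)
    + (b / 2 * (h t * p.[x t] * sink (k + 1) t)
       + b / 2 * (h t * p.[x t] * sink (k - 1) t))
    + (- (c / 2) * (h t * p.[x t] * cosk (k + 1) t)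
       + c / 2 * (h t * p.[x t] * cosk (k - 1) t))
    + d * (h t * sink k t)).
    by repeat apply: null_integralD; apply: null_integralZ.
  congr null_integral: e; apply/funext => t.
  by rewrite hornerMXaddC -/(x t) !(coskD, sinkD) !(coskN, sinkN) /x; field.
Qed.
(* [arc b] crosses 1/2 exactly at 0 and b, so that composing [step_poly n] with
   it approximates the indicator of ]0, b[ by trigonometric polynomials. *)
Definition arc (b t : R) : R :=
  (2^-1 + cos (pi * b) / 4) + (- cos (pi * b) / 4) * cosk 1 t +
  (- sin (pi * b) / 4) * sink 1 t.

Lemma arcE b t : arc b t = 2^-1 - (cos (2 * pi * t - pi * b) - cos (pi * b)) / 4.
Proof. by rewrite /arc /cosk /sink mulr1 cosB; field. Qed.

(** A difference of two cosines is at most 2 in absolute value, so the divisor 4 keeps [arc] within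
    1/2 of 1/2, in the range where [step_poly] is bounded. *)
Lemma arc01 b t : 0 <= arc b t <= 1.
Proof.
rewrite arcE; have := cos_le1 (pi * b); have := cos_geN1 (pi * b).
by have := cos_le1 (2 * pi * t - pi * b); have := cos_geN1 (2 * pi * t - pi * b); lra.
Qed.

(** For t in ]0, b[ the angle 2 pi t - pi b is below pi b in absolute value, and cosine decreases on
    [0, pi]. *)
Lemma arc_lt b t : 0 < b < 1 -> 0 < t < b -> arc b t < 2^-1.
Proof.
move=> b01 t0b; rewrite arcE -(cos_norm (2 * _ * _ - _)).
have p0 : 0 < (pi : R) := pi_gt0 R.
have ab : `|2 * pi * t - pi * b| < pi * b.
  rewrite (_ : 2 * pi * t - pi * b = pi * (2 * t - b)); last by ring.
  by rewrite normrM gtr0_norm// ltr_pM2l// ltr_norml; lra.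
suff : cos (pi * b) < cos `|2 * pi * t - pi * b| by lra.
rewrite ltr_cos// in_itv/=; last by apply/andP; split; nra.
rewrite normr_ge0/=; apply: (le_trans (ltW ab)); nra.
Qed.

(** The angle now lies in ]pi b, 2 pi - pi b[, where cosine is below cos (pi b). *)
Lemma arc_gt b t : 0 < b < 1 -> b < t < 1 -> 2^-1 < arc b t.
Proof.
move=> b01 tb1; rewrite arcE.
have p0 : 0 < (pi : R) := pi_gt0 R.
suff : cos (2 * pi * t - pi * b) < cos (pi * b) by lra.
have [tp|tp] := leP (2 * pi * t - pi * b) pi.
  by rewrite ltr_cos// ?in_itv/=; nra.
(* Beyond pi the angle is reflected to 2 pi minus itself, which is in ]pi b, pi[. *)
rewrite -[X in cos X]opprK cosN -cosD2pi -mulr_natl ltr_cos ?in_itv/=; nra.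
Qed.
Lemma measurable_arc b : measurable_fun [set: R] (arc b).
Proof.
apply: continuous_measurable_fun; rewrite (_ : arc b =
  fun t => 2^-1 - (cos (2 * pi * t - pi * b) - cos (pi * b)) / 4); last first.
  by apply/funext => t; rewrite arcE.
move=> t; apply: cvgB; first exact: cvg_cst.
apply: cvgM; last exact: cvg_cst.
apply: cvgB; last exact: cvg_cst.
apply: (continuous_comp (f := fun t => 2 * pi * t - pi * b)); last exact: continuous_cos.
apply: cvgB; last exact: cvg_cst.
by apply: cvgM; [exact: cvg_cst|exact: cvg_id].
Qed.

(** [step_poly] composed with [arc] is a trigonometric polynomial, so its integral against h
    vanishes. This passes to the limit: the approximants lie in [0, 1], hence |h| dominates. *)
Lemma null_integral_arc (h : R -> R) :
  (forall k, null_integral (fun t => h t * cosk k t)) ->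
  (forall k, null_integral (fun t => h t * sink k t)) ->
  forall b : R, 0 < b < 1 -> \int[mu]_(t in D) (h t * \1_`]0, b[ t) = 0.
Proof.
move=> hc hs b b01.
have [hi _] : null_integral h.
  congr null_integral: (hc 0); apply/funext => t.
  by rewrite /cosk mulr0 mul0r cos0 mulr1.
have mh : measurable_fun D h by apply/measurable_EFinP; case/integrableP: hi.
pose f_ n t := (h t * (step_poly R n).[arc b t])%:E.
have mf_ n : measurable_fun D (f_ n).
  apply/measurable_EFinP; apply: measurable_funM => //.
  apply: measurable_funTS; under eq_fun do rewrite step_polyE.
  apply: measurable_funX; apply: measurable_funB => //.
  by apply: measurable_funX; exact: measurable_arc.
have f_0 n : (\int[mu]_(t in D) f_ n t = 0)%E.
  have [fi f0] : null_integral (fun t => h t * (step_poly R n).[arc b t]).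
    have [e _] := null_integral_trig_poly (2^-1 + cos (pi * b) / 4)
      (- cos (pi * b) / 4) (- sin (pi * b) / 4) (step_poly R n) hc hs 0.
    congr null_integral: e.
    by apply/funext => t; rewrite [cosk 0 t]/cosk mulr0 mul0r cos0 mulr1.
  by rewrite -[LHS]fineK ?integrable_fin_num//; congr EFin.
have mf : measurable_fun D (fun t => (h t * \1_`]0, b[ t)%:E).
  by apply/measurable_EFinP; apply: measurable_funM.
have [||||] := @dominated_convergence _ _ _ mu D _ f_ (fun t => (h t * \1_`]0, b[ t)%:E)
    (fun t => `|h t|%:E) mf_ mf.
- exact: measurable_itv.
(* At 0 and b, [arc] equals 1/2, where [step_poly] tends to 1/e instead of 0 or 1. *)
- exists ([set 0] `|` [set b]); split.
  + by apply: measurableU.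
  + by rewrite null_set_setU//; exact: lebesgue_measure_set1.
  move=> t /= nt; apply: contrapT => /not_orP[t0 tb]; apply: nt.
  rewrite in_itv/= => /andP[t0' t1]; apply: cvg_EFin; first exact: nearW.
  rewrite /=; apply: cvgM; first exact: cvg_cst.
  rewrite indicE; have [tltb|] := ltP t b.
    rewrite mem_set/=; last first.
      by rewrite in_itv/= tltb andbT lt_neqAle t0' andbT eq_sym; apply/eqP.
    apply: step_poly_cvg1; have /andP[-> _] := arc01 b t; apply: arc_lt => //.
    by rewrite tltb andbT lt_neqAle t0' andbT eq_sym; apply/eqP.
  move=> bt; have {}bt : b < t by rewrite lt_neqAle bt andbT eq_sym; apply/eqP.
  rewrite memNset/=; last by rewrite in_itv/= => /andP[_]; rewrite ltNge ltW.
  apply: step_poly_cvg0; have /andP[_ ->] := arc01 b t; rewrite andbT; apply: arc_gt => //.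
  by rewrite bt t1.
- exact: integrable_norm.
- apply: aeW => t n _; rewrite /f_ /= lee_fin normrM ler_piMr//.
  by have := step_poly01 n (arc01 b t) => /andP[s0 s1]; rewrite ger0_norm.
move=> _ _; under eq_fun do rewrite f_0.
move=> /(cvg_unique _ (@cvg_cst _ _ _ _ _)) => /(_ (@ereal_hausdorff _)).
by rewrite /Rintegral => <-.
Qed.
(** The primitive from 0 of h restricted to [0, 1[ is identically zero, and by Lebesgue's
    differentiation theorem its derivative is h almost everywhere. *)
Lemma fourier_uniqueness (h : R -> R) :
  (forall k, null_integral (fun t => h t * cosk k t)) ->
  (forall k, null_integral (fun t => h t * sink k t)) ->
  {ae mu, forall t, D t -> h t = 0}.
Proof.
move=> hc hs.
have [hi h0] : null_integral h.
  congr null_integral: (hc 0); apply/funext => t.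
  by rewrite /cosk mulr0 mul0r cos0 mulr1.
have hDi : mu.-integrable setT (EFin \o (h \_ D)).
  by move: hi; rewrite integrable_mkcond//= restrict_EFin.
have F0 : (fun x => \int[mu]_(t in [set` Interval (BLeft 0) (BRight x)]) ((h \_ D) t))
    = cst 0.
  apply/funext => x /=; have [x0|x0|->] := ltgtP x 0.
  - by rewrite set_itv_ge ?Rintegral_set0// bnd_simp -ltNge.
  - have [x1|x1] := leP 1 x.
      rewrite -[RHS]h0 [LHS]Rintegral_mkcond [RHS]Rintegral_mkcond.
      apply: eq_Rintegral => t _; rewrite !patchE; case: ifPn => //; case: ifPn => //.
      rewrite !inE/= !in_itv/= => /andP[t0 t1] /negP; rewrite inE/= in_itv/=.
      by rewrite t0 (le_trans (ltW t1)).
    have b01 : 0 < x < 1 by rewrite x0 x1.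
    rewrite -[RHS](null_integral_arc hc hs b01) -Rintegral_itv_obnd_cbnd; last first.
      by apply: (integrableS measurableT _ _ hDi).
    rewrite -Rintegral_itv_bndo_bndc; last by apply: (integrableS measurableT _ _ hDi).
    rewrite [LHS]Rintegral_mkcond [RHS]Rintegral_mkcond; apply: eq_Rintegral => t _.
    rewrite !patchE indicE; case: (t \in `]0, x[%classic); case: (t \in D) => //.
    + by rewrite mulr1.
    + by rewrite mulr0.
  - by rewrite set_itv1 Rintegral_set1.
have intD y : mu.-integrable [set` Interval (BLeft 0) (BRight y)] (EFin \o (h \_ D)).
  by apply: (integrableS measurableT _ _ hDi).
(* The differentiation theorem speaks only of points strictly above the base point 0 of the
   primitive. *)
have n0 : {ae mu, forall t : R, t != 0}.
  exists [set 0]; split => //; first exact: lebesgue_measure_set1.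
  by move=> t /= /negP; rewrite negbK => /eqP.
have lD : locally_integrable [set: R] (h \_ D).
  by apply: open_integrable_locally => //; exact: openT.
have := FTC1 intD lD; rewrite F0 => h'.
apply: (filterS2 (ae_filter_ringOfSetsType mu) _ h' n0) => t ht t0 tD.
move: (tD); rewrite /= in_itv/= => /andP[t0' t1].
case: ht => [|_]; first by rewrite lte_fin lt_neqAle eq_sym t0.
by rewrite derive1_cst patchE mem_set.
Qed.
End fourier_uniqueness.

(** * Real-valued periodization and integration against periodic weights *)

Section periodize.
Variable R : realType.
Local Notation mu := (@lebesgue_measure R).
Local Notation D := (`[0, 1[%classic : set R).
Implicit Types f psi : R -> R.

(* [fine] sends an infinite sum to 0. *)
Definition periodize f (t : R) : R :=
  fine (\esum_(k in [set: int]) (f (t + k%:~R))%:E)%E.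

Definition periodic1 psi := forall x (k : int), psi (x + k%:~R) = psi x.

Lemma measurable_shift f (k : int) : measurable_fun [set: R] f ->
  measurable_fun [set: R] (fun t : R => (f (t + k%:~R))%:E).
Proof.
by move=> mf; apply/measurable_EFinP; exact: (measurableT_comp mf (measurable_addr _)).
Qed.

Lemma measurable_shift_esum f : measurable_fun [set: R] f -> (forall x, 0 <= f x) ->
  measurable_fun [set: R] (fun t : R => \esum_(k in [set: int]) (f (t + k%:~R))%:E)%E.
Proof.
move=> mf f0; apply: measurable_int_esum => [k|k x]; last by rewrite lee_fin.
exact: measurable_shift.
Qed.

Lemma shift_esum_ge0 f t : (forall x, 0 <= f x) ->
  (0 <= \esum_(k in [set: int]) (f (t + k%:~R))%:E)%E.
Proof. by move=> f0; apply: esum_ge0 => k _; rewrite lee_fin. Qed.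

Lemma measurable_periodize f : measurable_fun [set: R] f -> (forall x, 0 <= f x) ->
  measurable_fun [set: R] (periodize f).
Proof.
by move=> mf f0; apply: measurableT_comp => //; exact: measurable_shift_esum.
Qed.

Lemma periodize_periodic f : periodic1 (periodize f).
Proof. by move=> x k; rewrite /periodize (esum_translation (fun y => (f y)%:E)). Qed.

Lemma periodize_ge0 f : (forall x, 0 <= f x) -> forall t, 0 <= periodize f t.
Proof. by move=> f0 t; rewrite /periodize fine_ge0// shift_esum_ge0. Qed.

(** The sum has finite integral over a period, hence is finite almost everywhere, and [fine] loses
    nothing there. *)
Lemma ae_periodize f : (forall x, 0 <= f x) -> mu.-integrable setT (EFin \o f) ->
  {ae mu, forall t, D t ->
    (\esum_(k in [set: int]) (f (t + k%:~R))%:E)%E = (periodize f t)%:E}.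
Proof.
move=> f0 fi; have mf : measurable_fun setT f.
  by apply/measurable_EFinP; case/integrableP: fi.
have : mu.-integrable D (fun t => \esum_(k in [set: int]) (f (t + k%:~R)%R)%:E)%E.
  apply/integrableP; split.
    by apply: measurable_funTS; exact: measurable_shift_esum.
  under eq_integral do rewrite gee0_abs ?shift_esum_ge0//.
  rewrite -(ge0_integral_periodization (f := EFin \o f))//; last first.
    exact/measurable_EFinP.
  exact: integrable_lty.
move=> /integrable_ae => /(_ (measurable_itv _)).
apply: (filterS (F := almost_everywhere mu)) => t fin tD.
by rewrite /periodize fineK ?fin.
Qed.

(** The 1-periodic factor is the same in every term and leaves the sum. *)
Lemma ge0_integral_periodize f psi :
  (forall x, 0 <= f x) -> mu.-integrable setT (EFin \o f) ->
  (forall x, 0 <= psi x) -> measurable_fun setT psi -> periodic1 psi ->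
  (\int[mu]_x (f x * psi x)%:E = \int[mu]_(t in D) (periodize f t * psi t)%:E)%E.
Proof.
move=> f0 fi psi0 mpsi psi1.
have mf : measurable_fun setT f.
  by apply/measurable_EFinP; case/integrableP: fi.
rewrite ge0_integral_periodization//; last 2 first.
- by apply/measurable_EFinP; exact: measurable_funM.
- by move=> x; rewrite lee_fin mulr_ge0.
have mZ t : (\esum_(k in [set: int]) (f (t + k%:~R) * psi (t + k%:~R))%:E =
    (psi t)%:E * \esum_(k in [set: int]) (f (t + k%:~R))%:E)%E.
  rewrite int_esumE; last by move=> k; rewrite lee_fin mulr_ge0.
  rewrite int_esumE; last by move=> k; rewrite lee_fin.
  rewrite -nneseriesZl; last by move=> n _; rewrite lee_fin.
  by apply: eq_eseriesr => n _; rewrite psi1 mulrC EFinM.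
under eq_integral do rewrite mZ.
apply: ge0_ae_eq_integral => //.
- apply: measurable_funTS; apply: emeasurable_funM; first exact/measurable_EFinP.
  exact: measurable_shift_esum.
- apply: measurable_funTS; apply/measurable_EFinP; apply: measurable_funM => //.
  exact: measurable_periodize.
- by move=> t _; rewrite mule_ge0 ?lee_fin ?shift_esum_ge0.
- by move=> t _; rewrite lee_fin mulr_ge0 ?periodize_ge0.
- have := ae_periodize f0 fi; apply: (filterS (F := almost_everywhere mu)) => t h tD.
  by rewrite h// muleC -EFinM.
Qed.

Lemma Rintegral_periodize f psi :
  (forall x, 0 <= f x) -> mu.-integrable setT (EFin \o f) ->
  measurable_fun setT psi -> periodic1 psi ->
  mu.-integrable setT (EFin \o (fun x => f x * psi x)) ->
  mu.-integrable D (EFin \o (fun x => periodize f x * psi x)) /\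
  \int[mu]_(t in D) (periodize f t * psi t) = \int[mu]_x (f x * psi x).
Proof.
move=> f0 fi mpsi psi1 fpi.
have mf : measurable_fun setT f by apply/measurable_EFinP; case/integrableP: fi.
have ip : mu.-integrable D (EFin \o (fun x => periodize f x * psi x)).
  apply/integrableP; split.
    apply: measurable_funTS; apply/measurable_EFinP; apply: measurable_funM => //.
    exact: measurable_periodize.
  case/integrableP : fpi => _; congr (_ < _)%E.
  under eq_integral do rewrite /= normrM ger0_norm//.
  rewrite (ge0_integral_periodize (psi := fun x => `|psi x|))//; last first.
  - by move=> x k; rewrite /= psi1.
  - exact: measurableT_comp.
  by apply: eq_integral => t _ /=; rewrite normrM ger0_norm ?periodize_ge0.
split => //.
(* The case of a nonnegative weight below |psi|, to be applied to the positive and negative parts of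
   psi. *)
have gen (psi' : R -> R) : (forall x, 0 <= psi' x) -> (forall x, psi' x <= `|psi x|) ->
    measurable_fun setT psi' -> periodic1 psi' ->
    [/\ mu.-integrable D (EFin \o (fun x => periodize f x * psi' x)),
     mu.-integrable setT (EFin \o (fun x => f x * psi' x)) &
     \int[mu]_(t in D) (periodize f t * psi' t) = \int[mu]_x (f x * psi' x)].
  move=> psi'0 le mpsi' psi'1; split.
  - apply: le_integrable ip => //.
      apply: measurable_funTS; apply/measurable_EFinP; apply: measurable_funM => //.
      exact: measurable_periodize.
    move=> x _ /=; rewrite lee_fin !normrM ler_wpM2l//.
    by rewrite ger0_norm.
  - apply: le_integrable fpi => //.
      by apply/measurable_EFinP; apply: measurable_funM.
    move=> x _ /=; rewrite lee_fin !normrM ler_wpM2l//.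
    by rewrite ger0_norm.
  - by rewrite /Rintegral ge0_integral_periodize.
have [pi1 pi2 pi3] : [/\ mu.-integrable D (EFin \o (fun x => periodize f x * psi^\+ x)),
     mu.-integrable setT (EFin \o (fun x => f x * psi^\+ x)) &
     \int[mu]_(t in D) (periodize f t * psi^\+ t) = \int[mu]_x (f x * psi^\+ x)].
  apply: gen.
  - exact: funrpos_ge0.
  - by move=> x; rewrite /funrpos ge_max ler_norm normr_ge0.
  - exact: measurable_funrpos.
  - by move=> x k; rewrite /funrpos psi1.
have [ni1 ni2 ni3] : [/\ mu.-integrable D (EFin \o (fun x => periodize f x * psi^\- x)),
     mu.-integrable setT (EFin \o (fun x => f x * psi^\- x)) &
     \int[mu]_(t in D) (periodize f t * psi^\- t) = \int[mu]_x (f x * psi^\- x)].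
  apply: gen.
  - exact: funrneg_ge0.
  - by move=> x; rewrite /funrneg ge_max -normrN ler_norm normr_ge0.
  - exact: measurable_funrneg.
  - by move=> x k; rewrite /funrneg psi1.
have pE x : psi x = psi^\+ x - psi^\- x by rewrite -[in LHS](funrposBneg psi).
under eq_Rintegral do rewrite pE mulrBr.
under [RHS]eq_Rintegral do rewrite pE mulrBr.
by rewrite !RintegralB// pi3 ni3.
Qed.
Lemma expi_period (a : R) (m : int) :
  cos (a + 2 * pi * m%:~R) = cos a /\ sin (a + 2 * pi * m%:~R) = sin a.
Proof.
have nat_case (n : nat) (b : R) :
    cos (b + 2 * pi * n%:R) = cos b /\ sin (b + 2 * pi * n%:R) = sin b.
  elim: n b => [|n ih] b; first by rewrite mulr0 addr0.
  rewrite (_ : b + _ = b + 2 * pi * n%:R + pi *+ 2); last first.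
    by rewrite -natr1 -mulr_natl; ring.
  by rewrite cosD2pi sinD2pi; exact: ih.
case: m => n; first exact: nat_case.
rewrite NegzE intrN mulrN.
by have [<- <-] := nat_case n.+1 (a - 2 * pi * n.+1%:R); rewrite subrK.
Qed.

Lemma cosk_periodic k : periodic1 (@cosk R k).
Proof.
move=> x m; rewrite /cosk (mulrDr (2 * pi * _)).
rewrite (_ : 2 * pi * k%:~R * m%:~R = 2 * pi * (k * m)%:~R).
  by rewrite (expi_period _ _).1.
by rewrite intrM !mulrA.
Qed.

Lemma sink_periodic k : periodic1 (@sink R k).
Proof.
move=> x m; rewrite /sink (mulrDr (2 * pi * _)).
rewrite (_ : 2 * pi * k%:~R * m%:~R = 2 * pi * (k * m)%:~R).
  by rewrite (expi_period _ _).2.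
by rewrite intrM !mulrA.
Qed.

Lemma continuous_cosk k : continuous (@cosk R k).
Proof.
move=> t; apply: (continuous_comp (f := fun t => 2 * pi * k%:~R * t)).
  by apply: cvgM; [exact: cvg_cst|exact: cvg_id].
exact: continuous_cos.
Qed.

Lemma measurable_cosk k : measurable_fun [set: R] (@cosk R k).
Proof. exact: continuous_measurable_fun (@continuous_cosk k). Qed.

Lemma continuous_sink k : continuous (@sink R k).
Proof.
move=> t; apply: (continuous_comp (f := fun t => 2 * pi * k%:~R * t)).
  by apply: cvgM; [exact: cvg_cst|exact: cvg_id].
exact: continuous_sin.
Qed.

Lemma measurable_sink k : measurable_fun [set: R] (@sink R k).
Proof. exact: continuous_measurable_fun (@continuous_sink k). Qed.

Lemma integrable_mul_le1 (A : set R) (f psi : R -> R) : measurable A ->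
  measurable_fun A psi -> (forall x, `|psi x| <= 1) ->
  mu.-integrable A (EFin \o f) -> mu.-integrable A (EFin \o (fun x => f x * psi x)).
Proof.
move=> mA mpsi psi1 fi; have /integrableP[/measurable_EFinP mf _] := fi.
apply: le_integrable fi => //; first by apply/measurable_EFinP; apply: measurable_funM.
by move=> x _; rewrite /= lee_fin normrM ler_piMr.
Qed.

(** The periodization of f is zero almost everywhere by uniqueness, after which even an unbounded
    periodic weight integrates to 0. This is what later allows Phi as a weight. *)
Lemma Rintegral_periodic_eq0 f :
  mu.-integrable setT (EFin \o f) ->
  (forall k, \int[mu]_x (f x * cosk k x) = 0) ->
  (forall k, \int[mu]_x (f x * sink k x) = 0) ->
  forall psi, measurable_fun setT psi -> periodic1 psi ->
  mu.-integrable setT (EFin \o (fun x => f x * psi x)) ->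
  \int[mu]_x (f x * psi x) = 0.
Proof.
move=> fi fc fs.
have mf : measurable_fun setT f by apply/measurable_EFinP; case/integrableP: fi.
have fpi : mu.-integrable setT (EFin \o f^\+) by exact: integrable_funrpos.
have fni : mu.-integrable setT (EFin \o f^\-) by exact: integrable_funrneg.
have fp0 x : 0 <= f^\+ x by exact: funrpos_ge0.
have fn0 x : 0 <= f^\- x by exact: funrneg_ge0.
(* The sums behind [periodize] are controlled for nonnegative functions, so f is periodized through
   its two parts. *)
pose h t := periodize f^\+ t - periodize f^\- t.
have fE x : f x = f^\+ x - f^\- x by rewrite -[in LHS](funrposBneg f).
have key psi : measurable_fun setT psi -> periodic1 psi ->
    mu.-integrable setT (EFin \o (fun x => f x * psi x)) ->
    mu.-integrable D (EFin \o (fun x => h x * psi x)) /\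
    \int[mu]_(t in D) (h t * psi t) = \int[mu]_x (f x * psi x).
  move=> mpsi psi1 fpsi.
  have ip : mu.-integrable setT (EFin \o (fun x => f^\+ x * psi x)).
    apply: le_integrable fpsi => //.
      by apply/measurable_EFinP; apply: measurable_funM => //; exact: measurable_funrpos.
    move=> x _; rewrite /= lee_fin !normrM ler_wpM2r// ger0_norm//.
    by rewrite /funrpos ge_max ler_norm normr_ge0.
  have inn : mu.-integrable setT (EFin \o (fun x => f^\- x * psi x)).
    apply: le_integrable fpsi => //.
      by apply/measurable_EFinP; apply: measurable_funM => //; exact: measurable_funrneg.
    move=> x _; rewrite /= lee_fin !normrM ler_wpM2r// ger0_norm//.
    by rewrite /funrneg ge_max -normrN ler_norm normr_ge0.
  have [p1 p2] := Rintegral_periodize fp0 fpi mpsi psi1 ip.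
  have [n1 n2] := Rintegral_periodize fn0 fni mpsi psi1 inn.
  split.
    apply: eq_integrable (integrableB _ p1 n1) => // x _.
    by rewrite /= -EFinB -mulrBl.
  under eq_Rintegral do rewrite mulrBl.
  rewrite RintegralB// p2 n2 -RintegralB//.
  by apply: eq_Rintegral => x _; rewrite -mulrBl -fE.
have h0 : {ae mu, forall t, D t -> h t = 0}.
  apply: fourier_uniqueness => k.
  - have [] := key (cosk k); [exact: measurable_cosk|exact: cosk_periodic| |by rewrite fc].
    apply: integrable_mul_le1 => //; first exact: measurable_cosk.
    by move=> x; exact: cos_max.
  - have [] := key (sink k); [exact: measurable_sink|exact: sink_periodic| |by rewrite fs].
    apply: integrable_mul_le1 => //; first exact: measurable_sink.
    by move=> x; exact: sin_max.
move=> psi mpsi psi1 fpsi; have [hi <-] := key _ mpsi psi1 fpsi.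
rewrite /Rintegral (ae_eq_integral (cst 0%E)) ?integral0//.
  exact: (measurable_int _ hi).
by apply: (filterS (F := almost_everywhere mu)) h0 => t ht tD; rewrite ht// mul0r.
Qed.

(** * Integrals of cosines and sines over one period *)

Lemma Rintegral_FTC (f F : R -> R) : continuous f ->
  (forall x : R, is_derive x (1 : R) F (f x)) -> \int[mu]_(t in D) f t = F 1 - F 0.
Proof.
move=> cf dF.
have fi : mu.-integrable `[0, 1] (EFin \o f).
  by apply: continuous_compact_integrable; [exact: segment_compact|
    exact: continuous_subspaceT].
rewrite Rintegral_itv_bndo_bndc; last first.
  by apply: integrableS fi => //; exact: subset_itv_co_cc.
rewrite /Rintegral (@continuous_FTC2 _ f F)//.
- exact: continuous_subspaceT.
- have cF x : {for x, continuous F}.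
    by apply: differentiable_continuous; apply/derivable1_diffP; exact: ex_derive.
  split.
  + by move=> x _; exact: ex_derive.
  + by apply: cvg_at_right_filter; exact: cF.
  + by apply: cvg_at_left_filter; exact: cF.
- by move=> x _; rewrite derive1E; exact: derive_val.
Qed.

Lemma Rintegral_cosk k : \int[mu]_(t in D) cosk k t = (k == 0)%:R.
Proof.
have [->|k0] := eqVneq k 0.
  under eq_Rintegral do rewrite /cosk mulr0 mul0r cos0.
  rewrite Rintegral_cst//=.
  by rewrite lebesgue_measure_itv/= lte_fin ltr01 oppr0 addr0 mulr1.
have w0 : 2 * pi * k%:~R != 0 :> R.
  by rewrite !mulf_neq0 ?pnatr_eq0 ?intr_eq0// gt_eqF ?pi_gt0.
have dF (x : R) : is_derive x (1 : R)
    (fun t => (2 * pi * k%:~R)^-1 * sin (2 * pi * k%:~R * t)) (@cosk R k x).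
  rewrite /cosk; move: (2 * pi * _) w0 => w w0.
  by apply: is_derive_eq; rewrite /GRing.scale/=; field.
rewrite (Rintegral_FTC (@continuous_cosk k) dF) mulr1 mulr0.
by have [_] := expi_period 0 k; rewrite add0r => ->; rewrite subrr.
Qed.

Lemma Rintegral_sink k : \int[mu]_(t in D) sink k t = 0.
Proof.
have [->|k0] := eqVneq k 0.
  under eq_Rintegral do rewrite /sink mulr0 mul0r sin0.
  by rewrite Rintegral_cst// mul0r.
have w0 : 2 * pi * k%:~R != 0 :> R.
  by rewrite !mulf_neq0 ?pnatr_eq0 ?intr_eq0// gt_eqF ?pi_gt0.
have dF (x : R) : is_derive x (1 : R)
    (fun t => - (2 * pi * k%:~R)^-1 * cos (2 * pi * k%:~R * t)) (@sink R k x).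
  rewrite /sink; move: (2 * pi * _) w0 => w w0.
  by apply: is_derive_eq; rewrite /GRing.scale/=; field.
rewrite (Rintegral_FTC (@continuous_sink k) dF) mulr1 mulr0.
by have [+ _] := expi_period 0 k; rewrite add0r => ->; rewrite subrr.
Qed.
End periodize.
(** * Complex integrals and bounded functionals on L2 *)

Section complex_pairing.
Variable R : realType.
Local Notation mu := (@lebesgue_measure R).
Implicit Types f g : R -> R[i].

Lemma ReImP (a b : R[i]) : Re a = Re b -> Im a = Im b -> a = b.
Proof. by case: a b => ? ? [? ?] /= -> ->. Qed.

Lemma normr_Re_le (z : R[i]) : `|Re z| <= normc z.
Proof. by case: z => a b /=; rewrite -sqrtr_sqr ler_wsqrtr// lerDl sqr_ge0. Qed.

Lemma normr_Im_le (z : R[i]) : `|Im z| <= normc z.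
Proof. by case: z => a b /=; rewrite -sqrtr_sqr ler_wsqrtr// lerDr sqr_ge0. Qed.

Lemma normc_le (z : R[i]) : normc z <= `|Re z| + `|Im z|.
Proof.
case: z => a b /=; rewrite -[leRHS]ger0_norm ?addr_ge0// -sqrtr_sqr ler_wsqrtr//.
rewrite sqrrD !real_normK ?num_real// addrAC lerDl.
by rewrite mulrn_wge0// mulr_ge0.
Qed.

Lemma normE_normc (z : R[i]) : `|z| = (normc z)%:C.
Proof. by rewrite normc_def; case: z. Qed.

Definition cmeasurable g := measurable_fun [set: R] (fun x => Re (g x)) /\
  measurable_fun [set: R] (fun x => Im (g x)).

Definition cintegrable g := mu.-integrable setT (EFin \o (fun x => Re (g x))) /\
  mu.-integrable setT (EFin \o (fun x => Im (g x))).

Lemma cmeasurableM f g : cmeasurable f -> cmeasurable g ->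
  cmeasurable (fun x => f x * g x).
Proof.
move=> [rf jf] [rg jg]; split.
- by under eq_fun do rewrite Re_mul; apply: measurable_funB; apply: measurable_funM.
- by under eq_fun do rewrite Im_mul; apply: measurable_funD; apply: measurable_funM.
Qed.

Lemma cintegrable_le (g : R -> R[i]) (b : R -> R) : cmeasurable g ->
  mu.-integrable setT (EFin \o b) -> (forall x, normc (g x) <= b x) -> cintegrable g.
Proof.
move=> [rg jg] bi gb; split; apply: le_integrable bi => //; try exact/measurable_EFinP.
- move=> x _; rewrite /= lee_fin; apply: le_trans (ler_norm _).
  exact: le_trans (normr_Re_le _) (gb x).
- move=> x _; rewrite /= lee_fin; apply: le_trans (ler_norm _).
  exact: le_trans (normr_Im_le _) (gb x).
Qed.

Lemma cintegral_linear a f g : cintegrable f -> cintegrable g ->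
  cintegral (fun x => a * f x + g x) = a * cintegral f + cintegral g.
Proof.
move=> [rf jf] [rg jg].
have iZ (c : R) (h : R -> R) : mu.-integrable setT (EFin \o h) ->
    mu.-integrable setT (EFin \o (fun x => c * h x)).
  by move=> hi; apply: eq_integrable (integrableZl _ c hi).
apply: ReImP; rewrite /cintegral ?Re_add ?Im_add ?Re_mul ?Im_mul/=.
- under eq_Rintegral do rewrite Re_add Re_mul.
  rewrite RintegralD//; first by rewrite RintegralB ?RintegralZl//; exact: iZ.
  by apply: eq_integrable (integrableB _ (iZ (Re a) _ rf) (iZ (Im a) _ jf)).
- under eq_Rintegral do rewrite Im_add Im_mul.
  rewrite RintegralD//; first by rewrite RintegralD ?RintegralZl//; exact: iZ.
  by apply: eq_integrable (integrableD _ (iZ (Re a) _ jf) (iZ (Im a) _ rf)).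
Qed.

Lemma ae_cintegral f g : cmeasurable f -> cmeasurable g ->
  {ae mu, forall x, f x = g x} -> cintegral f = cintegral g.
Proof.
move=> [rf jf] [rg jg] fg; apply: ReImP; rewrite /cintegral/=.
- congr fine; apply: ae_eq_integral => //; try exact/measurable_EFinP.
  by apply: (filterS (F := almost_everywhere mu)) fg => x + _ => /= ->.
- congr fine; apply: ae_eq_integral => //; try exact/measurable_EFinP.
  by apply: (filterS (F := almost_everywhere mu)) fg => x + _ => /= ->.
Qed.

Lemma cLnorm_ge0 f : 0 <= cLnorm 2 f.
Proof. by rewrite /cLnorm fine_ge0 ?Lnorm_ge0. Qed.

(** Cauchy-Schwarz, obtained as Hoelder's inequality with both exponents equal to 2. *)
Lemma integrable_normcM f g : cLfun 2 f -> cLfun 2 g ->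
  mu.-integrable setT (EFin \o (fun x => normc (f x) * normc (g x))) /\
  \int[mu]_x (normc (f x) * normc (g x)) <= cLnorm 2 f * cLnorm 2 g.
Proof.
move=> Lf Lg; have mf := measurable_cL2 Lf; have mg := measurable_cL2 Lg.
have := hoelder mu mf mg (ltr0n R 2) (ltr0n R 2).
have e : 2^-1 + 2^-1 = 1 :> R by field.
move=> /(_ e); rewrite (cL2_finite Lf) (cL2_finite Lg) Lnorm1 -EFinM => h.
have i : mu.-integrable setT (EFin \o (fun x => normc (f x) * normc (g x))).
  apply/integrableP; split; first by apply/measurable_EFinP; exact: measurable_funM.
  exact: le_lt_trans h (ltry _).
split => //; rewrite -lee_fin fineK ?integrable_fin_num//.
apply: le_trans h; apply: ge0_le_integral => //.
- by move=> x _; rewrite lee_fin mulr_ge0 ?normc_ge0r.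
- by apply/measurable_EFinP; exact: measurable_funM.
- by apply: measurableT_comp => //; apply/measurable_EFinP; exact: measurable_funM.
- by move=> x _; rewrite /= lee_fin ler_norm.
Qed.

Lemma cintegrable_mul f g : cLfun 2 f -> cLfun 2 g -> cintegrable (fun x => f x * g x).
Proof.
move=> Lf Lg; have [i _] := integrable_normcM Lf Lg.
apply: cintegrable_le i _; first by apply: cmeasurableM; [case: Lf|case: Lg].
by move=> x; rewrite normcM.
Qed.

(** The factor 2 comes from estimating real and imaginary parts separately; any constant serves for
    continuity. *)
Lemma normc_cintegral_le f g : cLfun 2 f -> cLfun 2 g ->
  normc (cintegral (fun x => f x * g x)) <= 2 * (cLnorm 2 f * cLnorm 2 g).
Proof.
move=> Lf Lg; have [i le] := integrable_normcM Lf Lg.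
have [ri ji] := cintegrable_mul Lf Lg.
apply: (le_trans (normc_le _)); rewrite mulr2n mulrDl mul1r.
by apply: lerD; (apply: le_trans le); (apply: (le_trans (le_normr_Rintegral _ _)) => //);
   apply: le_Rintegral => //; try exact: integrable_norm;
   move=> x _; rewrite -normcM; [exact: normr_Re_le|exact: normr_Im_le].
Qed.
Lemma cLfun_L2 (u : L2 R) : cLfun 2 (L2_to_fun u).
Proof. exact: cL2funP. Qed.

Lemma L2_to_fun_pi (f : cL2fun R) :
  {ae mu, forall x, L2_to_fun (\pi_(L2 R)%qT f) x = f x}.
Proof. by apply/eqL2P; rewrite reprK. Qed.

Lemma L2_to_fun_linear a (u v : L2 R) : {ae mu, forall x,
  L2_to_fun (a *: u + v) x = a * L2_to_fun u x + L2_to_fun v x}.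
Proof.
have : \pi_(L2 R)%qT (repr (a *: u + v)) = \pi_(L2 R)%qT (a *: repr u + repr v).
  by rewrite reprK -piL2D -piL2Z !reprK.
by move/eqL2P.
Qed.

Lemma L2_normE (u : L2 R) : `|u| = (cLnorm 2 (L2_to_fun u))%:C.
Proof. by []. Qed.

(** No conjugate is taken, which makes this complex linear in [u]; where an inner product is wanted,
    the conjugate is put into [w]. *)
Definition pairing (w : cL2fun R) (u : L2 R) : R[i]^o :=
  cintegral (fun x => L2_to_fun u x * w x).

Lemma pairing_linear w : linear (pairing w).
Proof.
move=> a u v; rewrite /pairing.
have Lw := cL2funP w.
rewrite -[RHS](@cintegral_linear a); try by apply: cintegrable_mul => //; exact: cLfun_L2.
have [ru ju _] := cLfun_L2 u; have [rv jv _] := cLfun_L2 v.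
have [rw jw _] := Lw.
apply: ae_cintegral.
- by apply: cmeasurableM => //; have [] := cLfun_L2 (a *: u + v).
- split.
  + by under eq_fun do rewrite Re_add !Re_mul !Im_mul; apply: measurable_funD;
      repeat (apply: measurable_funB || apply: measurable_funM || apply: measurable_funD).
  + by under eq_fun do rewrite Im_add !Im_mul !Re_mul; apply: measurable_funD;
      repeat (apply: measurable_funB || apply: measurable_funM || apply: measurable_funD).
- have := L2_to_fun_linear a u v.
  by apply: (filterS (F := almost_everywhere mu)) => x ->; rewrite mulrDl mulrA.
Qed.

HB.instance Definition _ w := GRing.isLinear.Build R[i] (L2 R) R[i]^o _ (pairing w)
  (pairing_linear w).

Lemma pairing_le w u : `|pairing w u| <= (2 * cLnorm 2 w)%:C * `|u|.
Proof.
rewrite L2_normE normE_normc.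
rewrite (_ : _ * _ = (2 * (cLnorm 2 (L2_to_fun u) * cLnorm 2 w))%:C); last first.
  by rewrite [cLnorm 2 (L2_to_fun u) * _]mulrC mulrA [RHS]rmorphM.
rewrite lecR.
by apply: normc_cintegral_le; [exact: cLfun_L2|exact: cL2funP].
Qed.
End complex_pairing.

(** * Continuous functionals and closed spans *)

Lemma le_linear_continuous (R : realType) (V W : normedModType R[i])
    (f : {linear V -> W}) (C : R) :
  (forall x, `|f x| <= C%:C * `|x|) -> continuous f.
Proof.
move=> fC; apply: bounded_linear_continuous; apply/linear_boundedP.
exists C%:C; split; first by rewrite realE (lecR 0) (lecR _ 0) -realE num_real.
by move=> r Cr x; apply: (le_trans (fC x)); rewrite ler_wpM2r// ltW.
Qed.

Lemma linear_closed_span_eq0 (K : numFieldType) (V : normedModType K)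
    (f : {linear V -> K^o}) (A : set V) : continuous f ->
  (forall x, A x -> f x = 0) -> forall x, closed_span A x -> f x = 0.
Proof.
move=> cf fA x Ax; apply/eqP/contraT => fx0.
have fx : 0 < `|f x| by rewrite normr_gt0.
(* The ball around f x of radius |f x| misses 0, yet by continuity it contains the value of f at
   some combination of elements of A, which is 0. *)
have /(_ (ball (f x) `|f x|)) := cf x; move=> /(_ (nbhsx_ballx _ _ fx)) nx.
have [y [[s [sA ->]]]] := Ax _ nx.
rewrite /ball/= linear_sum big1_seq ?subr0 ?ltxx// => p /andP[_ /sA Ap].
by rewrite linearZ/= fA// scaler0.
Qed.

(** A combination of generators approximating v in V is itself an element of the closed span, whose
    norm is that of V. *)
Lemma complete_clspan (K : numFieldType) (V : normedModType K) (I : Type) (y : I -> V) :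
  closed_span (range (fun k => clspan_of (imageT y k))) = [set: clspan (range y)].
Proof.
apply/seteqP; split => // -[v vA] _ U /nbhs_ballP[e /= e0 eU].
have /(_ (ball v e) (nbhsx_ballx _ _ e0)) := set_mem vA.
move=> [w [[s [sA ws]] vw]].
have [t [tA tw]] : exists t : seq (K * clspan (range y)),
    (forall p, p \in t -> range (fun k => clspan_of (imageT y k)) p.2) /\
    w = val (\sum_(p <- t) p.1 *: p.2).
  move: sA; rewrite ws; elim: s {ws} => [_|p s ih sA].
    by exists [::]; split => //; rewrite !big_nil.
  have [t [tA tE]] : exists t : seq (K * clspan (range y)),
    (forall p, p \in t -> range (fun k => clspan_of (imageT y k)) p.2) /\
    \sum_(p <- s) p.1 *: p.2 = val (\sum_(p <- t) p.1 *: p.2).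
    by apply: ih => q qs; apply: sA; rewrite inE qs orbT.
  have [k _ yk] := sA p (mem_head _ _).
  exists ((p.1, clspan_of (imageT y k)) :: t); split.
    by move=> q; rewrite inE => /orP[/eqP ->|/tA//]; exists k.
  by rewrite !big_cons tE -yk.
exists (\sum_(p <- t) p.1 *: p.2); split; first by exists t.
apply: eU; move: vw; rewrite tw -!ball_normE/=.
by [].
Qed.
(** * The Fourier transform of a translate *)

Section translation_modulation.
Variable R : realType.
Local Notation mu := (@lebesgue_measure R).

Lemma expiD (s t : R) : expi (s + t) = expi s * expi t.
Proof. by apply: ReImP; rewrite ?Re_mul ?Im_mul /expi/= ?cosD ?sinD// addrC. Qed.

Lemma normc_expi (t : R) : normc (expi t) = 1.
Proof. by rewrite /expi/= cos2Dsin2 sqrtr1. Qed.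

Lemma cmeasurable_expi (a : R) : cmeasurable (fun x => expi (a * x)).
Proof.
split => /=; apply: continuous_measurable_fun => t.
- apply: (continuous_comp (f := fun t => a * t)); last exact: continuous_cos.
  by apply: cvgM; [exact: cvg_cst|exact: cvg_id].
- apply: (continuous_comp (f := fun t => a * t)); last exact: continuous_sin.
  by apply: cvgM; [exact: cvg_cst|exact: cvg_id].
Qed.

Lemma cLfun_le (g f : R -> R[i]) : cmeasurable g -> cLfun 2 f ->
  (forall x, normc (g x) <= normc (f x)) -> cLfun 2 g.
Proof.
move=> [rg jg] Lf gf; have mf := measurable_cL2 Lf; split => //.
apply: (@le_lt_trans _ _ ('N[mu]_2%:E[EFin \o (fun x => normc (f x))])%E).
  apply: le_Lnorm2 => //; first exact: measurable_normc.
  by move=> x; rewrite !ger0_norm ?normc_ge0r.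
by case: Lf.
Qed.

Lemma cLnorm_le (g f : R -> R[i]) : cLfun 2 g -> cLfun 2 f ->
  (forall x, normc (g x) <= normc (f x)) -> cLnorm 2 g <= cLnorm 2 f.
Proof.
move=> Lg Lf gf; rewrite -lee_fin -!cL2_finite//; apply: le_Lnorm2.
- exact: measurable_cL2.
- exact: measurable_cL2.
- by move=> x; rewrite !ger0_norm ?normc_ge0r.
Qed.

Lemma cLnorm_sqr (f : R -> R[i]) : cLfun 2 f ->
  ((cLnorm 2 f ^+ 2)%:E = \int[mu]_x (normc (f x) ^+ 2)%:E)%E.
Proof.
move=> Lf.
have := @poweR_Lnorm _ _ _ mu (EFin \o (fun x => normc (f x))) 2.
rewrite pnatr_eq0 => /(_ isT); rewrite (cL2_finite Lf) poweR_EFin powR_mulrn ?cLnorm_ge0//.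
move=> ->; apply: eq_integral => x _.
by rewrite /= ger0_norm ?normc_ge0r// powR_mulrn ?normc_ge0r.
Qed.

Lemma Rintegral_translation (a : R) (f : R -> R) : measurable_fun [set: R] f ->
  \int[mu]_x f (x + a) = \int[mu]_x f x.
Proof.
move=> mf; rewrite /Rintegral integralE [in RHS]integralE.
have mfp : measurable_fun [set: R] (EFin \o f) by exact/measurable_EFinP.
congr (fine (_ - _)%E).
- rewrite -[RHS](ge0_integral_translation a)//; last exact: measurable_funepos.
  by apply: eq_integral => x _; rewrite !funeposE.
- rewrite -[RHS](ge0_integral_translation a)//; last exact: measurable_funeneg.
  by apply: eq_integral => x _; rewrite !funenegE.
Qed.

Lemma cintegral_translation (a : R) (f : R -> R[i]) : cmeasurable f ->
  cintegral (fun x => f (x + a)) = cintegral f.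
Proof.
move=> [rf jf]; apply: ReImP; rewrite /cintegral/=.
- by rewrite -[RHS](Rintegral_translation a rf).
- by rewrite -[RHS](Rintegral_translation a jf).
Qed.

Lemma cintegralZ (a : R[i]) (f : R -> R[i]) : cintegrable f ->
  cintegral (fun x => a * f x) = a * cintegral f.
Proof.
move=> fi.
have zi : @cintegrable R (fun=> 0) by split; exact: integrable0.
have := cintegral_linear a fi zi.
rewrite [cintegral (fun=> 0 : R[i])](_ : _ = 0) ?addr0.
  by under eq_fun do rewrite addr0.
by rewrite /cintegral /Rintegral integral0.
Qed.

Lemma integrable_normc_L1 (f : R -> R[i]) : cLfun 1 f ->
  mu.-integrable setT (EFin \o (fun x => normc (f x))).
Proof.
move=> [rf jf]; rewrite /finite_norm Lnorm1 => h; apply/integrableP; split => //.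
by apply/measurable_EFinP; exact: measurable_normc.
Qed.

Lemma cLfun1_translate (a : R) (f : R -> R[i]) : cLfun 1 f ->
  cLfun 1 (fun x => f (x + a)).
Proof.
move=> [rf jf]; rewrite /finite_norm Lnorm1 => h; split.
- exact: (measurableT_comp rf (measurable_addr a)).
- exact: (measurableT_comp jf (measurable_addr a)).
- rewrite /finite_norm Lnorm1.
  rewrite (ge0_integral_translation a (u := fun x => `|EFin (normc (f x))|%E))//.
  apply: measurableT_comp => //; apply/measurable_EFinP; exact: measurable_normc.
Qed.

(** Substituting x + a for x on the right-hand side creates a factor exp(- 2 i pi a y) in the
    kernel, which cancels the one in front. *)
Lemma fourier_integral_translate (a : R) (f : R -> R[i]) y : cLfun 1 f ->
  fourier_integral (fun x => f (x + a)) y = expi (2 * pi * a * y) * fourier_integral f y.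
Proof.
move=> Lf; rewrite /fourier_integral.
have me : cmeasurable (fun x => expi (- (2 * pi * x * y))).
  rewrite (_ : (fun x => _) = fun x => expi (- (2 * pi * y) * x)).
    exact: cmeasurable_expi.
  by apply/funext => x; congr expi; ring.
have mfe : cmeasurable (fun x => f x * expi (- (2 * pi * x * y))).
  by apply: cmeasurableM => //; case: Lf.
rewrite -cintegralZ.
  rewrite -[RHS](cintegral_translation a); last first.
    by apply: cmeasurableM => //; split; exact: measurable_cst.
  congr cintegral; apply/funext => x.
  rewrite mulrCA -expiD; congr (_ * expi _); ring.
apply: (cintegrable_le mfe (integrable_normc_L1 Lf)) => x.
by rewrite normcM normc_expi mulr1.
Qed.

(** * Density of integrable functions in L2 by truncation *)

Lemma integrable_normc_sqr (f : R -> R[i]) : cLfun 2 f ->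
  mu.-integrable setT (EFin \o (fun x => normc (f x) ^+ 2)).
Proof.
move=> Lf; have [i _] := integrable_normcM Lf Lf.
by apply: eq_integrable i => // x _ /=; rewrite expr2.
Qed.

Definition truncate (n : nat) (f : R -> R[i]) (x : R) : R[i] :=
  f x * (\1_`[- n%:R, n%:R] x : R)%:C.

Lemma normc_indic (A : set R) x : normc (\1_A x : R)%:C = \1_A x.
Proof. by rewrite /= expr0n/= addr0 sqrtr_sqr ger0_norm. Qed.

Lemma cmeasurable_truncate n f : cmeasurable f -> cmeasurable (truncate n f).
Proof.
move=> mf; apply: cmeasurableM => //; split => /=; last exact: measurable_cst.
exact: measurable_indic.
Qed.

Lemma cLfun2_truncate n f : cLfun 2 f -> cLfun 2 (truncate n f).
Proof.
move=> Lf; apply: (@cLfun_le _ f) => //.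
  by apply: cmeasurable_truncate; case: Lf.
by move=> x; rewrite /truncate normcM normc_indic ler_piMr ?normc_ge0r.
Qed.

Lemma cLfun1_truncate n f : cLfun 2 f -> cLfun 1 (truncate n f).
Proof.
move=> Lf; have [rt jt] : cmeasurable (truncate n f).
  by apply: cmeasurable_truncate; case: Lf.
split => //; rewrite /finite_norm Lnorm1.
suff : mu.-integrable setT (EFin \o (fun x => normc (truncate n f x))).
  by case/integrableP.
(* On [-n, n] the bound t <= t^2 + 1 for t >= 0 makes |f|^2 plus an indicator a dominating
   function. *)
have bi := integrableD measurableT (integrable_normc_sqr Lf)
  (integrable_indic_itv (- n%:R) (n%:R : R) true false).
apply: le_integrable bi => //.
  by apply/measurable_EFinP; exact: measurable_normc.
move=> x _; rewrite /= lee_fin /truncate normcM normc_indic.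
have f0 : 0 <= normc (f x) by exact: normc_ge0r.
rewrite !ger0_norm ?mulr_ge0 ?addr_ge0 ?sqr_ge0// indicE.
case: (_ \in _); last by rewrite mulr0 addr0 sqr_ge0.
by rewrite mulr1 -[true%:R]/(1 : R); have := sqr_ge0 (normc (f x) - 1); nra.
Qed.

(** At each x the difference is 0 as soon as n exceeds |x|, and |f|^2 dominates its square. *)
Lemma truncate_dense f : cLfun 2 f -> forall e : R, 0 < e ->
  exists n, cLnorm 2 (fun x => f x - truncate n f x) < e.
Proof.
move=> Lf e e0.
have subE n x : f x - truncate n f x = f x * (1 - \1_`[- n%:R, n%:R] x : R)%:C.
  by rewrite /truncate rmorphB/= mulrBr mulr1.
have mI n : measurable_fun [set: R] (fun x : R => (1 - \1_`[- n%:R, n%:R] x : R)).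
  by apply: measurable_funB => //; exact: measurable_indic.
have nsub n x : normc (f x - truncate n f x) = normc (f x) * (1 - \1_`[- n%:R, n%:R] x).
  rewrite subE normcM; congr (_ * _).
  by rewrite /= expr0n/= addr0 sqrtr_sqr ger0_norm// subr_ge0 indicE; case: (_ \in _).
have ind1 n (x : R) : 0 <= (1 - \1_`[- n%:R, n%:R] x : R) <= 1.
  by rewrite indicE; case: (_ \in _); rewrite ?subrr ?subr0 ?lexx ?ler01.
have Ls n : cLfun 2 (fun x => f x - truncate n f x).
  apply: (@cLfun_le _ f) => //.
    under eq_fun do rewrite subE; apply: cmeasurableM; first by case: Lf.
    by split => //=; exact: measurable_cst.
  by move=> x; have /andP[_ ?] := ind1 n x; rewrite nsub ler_piMr ?normc_ge0r.
have mf := measurable_cL2 Lf.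
pose f_ n x := (normc (f x - truncate n f x) ^+ 2)%:E.
have [||||||] := @dominated_convergence _ _ _ mu setT _ f_ (cst 0%E)
    (EFin \o (fun x => normc (f x) ^+ 2)).
- exact: measurableT.
- move=> n; apply/measurable_EFinP; apply: measurable_funX.
  exact: (measurable_cL2 (Ls n)).
- exact: measurable_cst.
- apply: aeW => x _; apply: cvg_near_cst.
  exists (Num.truncn `|x|).+1 => // n /= xn.
  rewrite /f_ nsub indicE mem_set ?subrr ?mulr0 ?expr0n//=.
  rewrite in_itv/= -ler_norml; apply: ltW; apply: (lt_le_trans (truncnS_gt _)).
  by rewrite ler_nat.
- exact: integrable_normc_sqr.
- apply: aeW => x n _; rewrite /f_ /= nsub lee_fin ger0_norm ?sqr_ge0//.
  by have /andP[? ?] := ind1 n x; rewrite exprMn ler_piMr ?sqr_ge0// exprn_ile1.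
move=> _ _; rewrite integral0 => /fine_cvgP[_].
move=> /cvgr0Pnorm_lt /(_ (e ^+ 2)); rewrite exprn_gt0// => /(_ isT)[N _ HN].
exists N; have := HN N (leqnn N); rewrite /= -/(f_ N).
rewrite -cLnorm_sqr//= ger0_norm ?sqr_ge0//.
by rewrite ltr_pXn2r ?nnegrE ?cLnorm_ge0// ltW.
Qed.
Lemma translateB a (u v : L2 R) : translate a (u - v) = translate a u - translate a v.
Proof.
elim/quotW: u => f; elim/quotW: v => g.
by rewrite -raddfB !translate_pi -raddfB; apply/eqL2P; apply: aeW.
Qed.

Lemma norm_translate a (u : L2 R) : `|translate a u| = `|u|.
Proof.
elim/quotW: u => f; rewrite translate_pi.
rewrite [LHS]L2norm_pi [RHS]L2norm_pi; congr _%:C.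
apply/eqP; rewrite -(@eqrXn2 _ 2%N) ?cLnorm_ge0//; apply/eqP.
apply: EFin_inj; rewrite !cLnorm_sqr; [|exact: cL2funP|exact: (cL2funP (CL2fun _))].
rewrite -[RHS](ge0_integral_translation a)//.
- by apply/measurable_EFinP; apply: measurable_funX; apply: measurable_cL2; exact: cL2funP.
- by move=> x; rewrite lee_fin sqr_ge0.
Qed.

Lemma cL2_modulate (a : R) (f : cL2fun R) :
  (fun y => expi (2 * pi * a * y) * f y) \in @cL2pred R.
Proof.
rewrite inE; apply: (@cLfun_le _ f); last 2 first.
- exact: cL2funP.
- by move=> x; rewrite normcM normc_expi mul1r.
by apply: cmeasurableM; [exact: cmeasurable_expi|case: (cL2funP f)].
Qed.

Definition modulate a (u : L2 R) : L2 R := \pi_(L2 R)%qT (CL2fun (cL2_modulate a (repr u))).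

Lemma modulate_pi a f :
  modulate a (\pi_(L2 R)%qT f) = \pi_(L2 R)%qT (CL2fun (cL2_modulate a f)).
Proof.
apply/eqL2P; have := L2_to_fun_pi f.
by apply: (filterS (F := almost_everywhere mu)) => x fx; congr (_ * _).
Qed.

Lemma modulateB a (u v : L2 R) : modulate a (u - v) = modulate a u - modulate a v.
Proof.
elim/quotW: u => f; elim/quotW: v => g.
rewrite -raddfB !modulate_pi -raddfB; apply/eqL2P; apply: aeW => x /=.
exact: mulrBr.
Qed.

Lemma norm_modulate a (u : L2 R) : `|modulate a u| = `|u|.
Proof.
elim/quotW: u => f; rewrite modulate_pi.
rewrite [LHS]L2norm_pi [RHS]L2norm_pi; congr _%:C.
have n x : normc (CL2fun (cL2_modulate a f) x) = normc (f x).
  by rewrite normcM normc_expi mul1r.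
by apply/eqP; rewrite eq_le; apply/andP; split; apply: cLnorm_le;
  (try exact: cL2funP) => x; rewrite n.
Qed.

(** The defect [d] between the two sides is additive and bounded by 2 |v|. It vanishes on classes
    with an integrable representative, where the integral formula applies, and these are dense. *)
Lemma fourier_translate (F : {linear L2 R -> L2 R}) (a : R) (u : L2 R) :
  is_fourier_transform F -> F (translate a u) = modulate a (F u).
Proof.
move=> [Fnorm Fint]; apply/eqP; rewrite -subr_eq0; apply/eqP.
pose d v := F (translate a v) - modulate a (F v).
have dB v w : d v - d w = d (v - w).
  by rewrite /d translateB !(raddfB F) modulateB opprD addrACA -opprD.
have d_le v : `|d v| <= 2 * `|v|.
  rewrite mulr2n mulrDl mul1r; apply: (le_trans (ler_normB _ _)).
  by rewrite Fnorm norm_translate norm_modulate Fnorm.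
have d0 (f : cL2fun R) : cLfun 1 f -> d (\pi_(L2 R)%qT f) = 0.
  move=> f1; apply/eqP; rewrite subr_eq0; apply/eqP.
  rewrite translate_pi -[LHS]reprK; apply/eqL2P.
  have := Fint (CL2fun (cL2_translate f a)) (cLfun1_translate a f1).
  have := Fint _ f1.
  apply: (filterS2 (ae_filter_ringOfSetsType mu)) => y fy fay.
  by rewrite -[LHS]/(L2_to_fun _ y) fay fourier_integral_translate// -fy.
rewrite -/(d u); apply/normr0_eq0; rewrite L2_normE.
suff -> : cLnorm 2 (L2_to_fun (d u)) = 0 by [].
apply/eqP; rewrite eq_le cLnorm_ge0 andbT; apply/ler_addgt0Pr => e e0.
(* Half of e compensates the factor 2 in [d_le]. *)
have e2 : 0 < e / 2 by rewrite divr_gt0.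
have [n ne] := truncate_dense (cLfun_L2 u) e2.
pose g := CL2fun (mem_set (cLfun2_truncate n (cLfun_L2 u)) : _ \in @cL2pred R).
have := d_le (u - \pi_(L2 R)%qT g).
rewrite -dB (d0 g) ?subr0; last exact: (cLfun1_truncate n (cLfun_L2 u)).
have -> : `|u - \pi_(L2 R)%qT g| =
    (cLnorm 2 (fun x => L2_to_fun u x - truncate n (L2_to_fun u) x))%:C.
  by rewrite -{1}[u]reprK -raddfB [LHS]L2norm_pi.
rewrite L2_normE -[2]/(2%:R) -(rmorph_nat (real_complex R)) -rmorphM lecR add0r.
by move=> /le_trans; apply; rewrite -ler_pdivlMl// mulrC ltW.
Qed.
End translation_modulation.

(** * Exponentials and periodic weights for complex functions *)

Section periodic_weights.
Variable R : realType.
Local Notation mu := (@lebesgue_measure R).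

Definition ek (k : int) (x : R) : R[i] := expi (2 * pi * k%:~R * x).

Lemma ReE_ek k x : Re (ek k x) = cosk k x. Proof. by []. Qed.
Lemma ImE_ek k x : Im (ek k x) = sink k x. Proof. by []. Qed.

Lemma ekD j k x : ek (j + k) x = ek j x * ek k x.
Proof. by rewrite /ek -expiD intrD mulrDr mulrDl. Qed.

Lemma normc_ek k x : normc (ek k x) = 1. Proof. exact: normc_expi. Qed.

Lemma cmeasurable_ek k : cmeasurable (ek k).
Proof. exact: cmeasurable_expi. Qed.

Lemma normc_conj (z : R[i]) : normc (z^*)%C = normc z.
Proof. by case: z => a b /=; rewrite sqrrN. Qed.

Lemma cmeasurable_conj (f : R -> R[i]) : cmeasurable f -> cmeasurable (fun x => (f x)^*%C).
Proof.
move=> [rf jf]; split.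
- by rewrite (_ : (fun x => _) = fun x => Re (f x)); last by apply/funext => x; case: (f x).
- rewrite (_ : (fun x => _) = fun x => - Im (f x)); last by apply/funext => x; case: (f x).
  exact: measurable_funN.
Qed.

Lemma cintegral_conj (f : R -> R[i]) : cintegrable f ->
  cintegral (fun x => (f x)^*%C) = ((cintegral f)^*)%C.
Proof.
move=> [rf jf]; apply: ReImP; rewrite /cintegral/=.
- by apply: eq_Rintegral => x _; case: (f x).
- rewrite -mulN1r -RintegralZl//; apply: eq_Rintegral => x _.
  by case: (f x) => a b; rewrite mulN1r.
Qed.

Lemma cmeasurable_real (psi : R -> R) : measurable_fun [set: R] psi ->
  cmeasurable (fun x => (psi x)%:C).
Proof. by move=> mpsi; split => //=; exact: measurable_cst. Qed.

Lemma normc_real (x : R) : normc x%:C = `|x|.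
Proof. by rewrite /= expr0n addr0 sqrtr_sqr. Qed.

Lemma Re_mul_real (z : R[i]) (x : R) : Re (z * x%:C) = Re z * x.
Proof. by rewrite Re_mul/= mulr0 subr0. Qed.

Lemma Im_mul_real (z : R[i]) (x : R) : Im (z * x%:C) = Im z * x.
Proof. by rewrite Im_mul/= mulr0 add0r. Qed.

(** Complex counterpart of [Rintegral_periodic_eq0]. A single complex coefficient only relates the
    real integrals to each other; those at k and - k together separate them. *)
Lemma cintegral_periodic_eq0 (G : R -> R[i]) : cintegrable G ->
  (forall k, cintegral (fun x => G x * ek k x) = 0) ->
  forall psi : R -> R, measurable_fun setT psi -> periodic1 psi ->
  mu.-integrable setT (EFin \o (fun x => normc (G x) * psi x)) ->
  forall k, cintegral (fun x => G x * (psi x)%:C * ek k x) = 0.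
Proof.
move=> [rG jG] Gk.
have mrG : measurable_fun setT (fun x => Re (G x)).
  by apply/measurable_EFinP; case/integrableP: rG.
have mjG : measurable_fun setT (fun x => Im (G x)).
  by apply/measurable_EFinP; case/integrableP: jG.
have ic (h : R -> R) (k : int) : mu.-integrable setT (EFin \o h) ->
    mu.-integrable setT (EFin \o (fun x => h x * cosk k x)).
  by move=> hi; apply: integrable_mul_le1 => //;
    [exact: measurable_cosk|move=> x; exact: cos_max].
have is_ (h : R -> R) (k : int) : mu.-integrable setT (EFin \o h) ->
    mu.-integrable setT (EFin \o (fun x => h x * sink k x)).
  by move=> hi; apply: integrable_mul_le1 => //;
    [exact: measurable_sink|move=> x; exact: sin_max].
have r k : \int[mu]_x (Re (G x) * cosk k x) = \int[mu]_x (Im (G x) * sink k x).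
  have := congr1 (@complex.Re R) (Gk k); rewrite /cintegral/=.
  under eq_Rintegral do rewrite Re_mul ReE_ek ImE_ek.
  by rewrite RintegralB//; [move/eqP; rewrite subr_eq0 => /eqP|exact: ic|exact: is_].
have i k : \int[mu]_x (Re (G x) * sink k x) = - \int[mu]_x (Im (G x) * cosk k x).
  have := congr1 (@complex.Im R) (Gk k); rewrite /cintegral/=.
  under eq_Rintegral do rewrite Im_mul ReE_ek ImE_ek.
  by rewrite RintegralD//; [move/eqP; rewrite addr_eq0 => /eqP|exact: is_|exact: ic].
have cN (h : R -> R) (k : int) :
    \int[mu]_x (h x * cosk (- k) x) = \int[mu]_x (h x * cosk k x).
  by apply: eq_Rintegral => x _; rewrite coskN.
have sN (h : R -> R) (k : int) : mu.-integrable setT (EFin \o h) ->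
    \int[mu]_x (h x * sink (- k) x) = - \int[mu]_x (h x * sink k x).
  move=> hi; rewrite -[RHS]mulN1r -[RHS]RintegralZl//; last exact: is_.
  by apply: eq_Rintegral => x _; rewrite sinkN mulrN mulN1r.
(* Indices k and - k make the integral of Re G cos k equal to plus and to minus that of Im G sin k,
   so both vanish. *)
have Rc k : \int[mu]_x (Re (G x) * cosk k x) = 0.
  by have := r (- k); rewrite cN sN// -r; lra.
have Is k : \int[mu]_x (Im (G x) * sink k x) = 0 by rewrite -r.
have Rs k : \int[mu]_x (Re (G x) * sink k x) = 0.
  by have := i (- k); rewrite cN sN// -i; lra.
have Ic k : \int[mu]_x (Im (G x) * cosk k x) = 0.
  by have := i k; rewrite Rs; lra.
move=> psi mpsi psi1 Gpsi k.
have rpsi (h : R -> R) : (forall x, `|h x| <= normc (G x)) -> measurable_fun setT h ->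
    mu.-integrable setT (EFin \o (fun x => h x * psi x)).
  move=> hG mh; apply: le_integrable Gpsi => //.
    by apply/measurable_EFinP; exact: measurable_funM.
  by move=> x _; rewrite /= lee_fin !normrM ler_wpM2r// (le_trans (hG x))// ler_norm.
have rGp := rpsi _ (fun x => normr_Re_le _) mrG.
have jGp := rpsi _ (fun x => normr_Im_le _) mjG.
(* The real result is applied with the weights psi cos k and psi sin k, which are still
   1-periodic. *)
have pc : measurable_fun setT (fun x => psi x * cosk k x).
  by apply: measurable_funM => //; exact: measurable_cosk.
have ps : measurable_fun setT (fun x => psi x * sink k x).
  by apply: measurable_funM => //; exact: measurable_sink.
have pc1 : periodic1 (fun x => psi x * cosk k x).
  by move=> x m; rewrite psi1 cosk_periodic.
have ps1 : periodic1 (fun x => psi x * sink k x).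
  by move=> x m; rewrite psi1 sink_periodic.
have assoc (h1 h2 : R -> R) :
    mu.-integrable setT (EFin \o (fun x => h1 x * psi x * h2 x)) ->
    mu.-integrable setT (EFin \o (fun x => h1 x * (psi x * h2 x))).
  by apply: eq_integrable => // x _ /=; rewrite mulrA.
apply: ReImP; rewrite /cintegral/=.
- under eq_Rintegral do rewrite Re_mul Re_mul_real Im_mul_real ReE_ek ImE_ek -!mulrA.
  rewrite RintegralB//; try by apply: assoc; (exact: ic || exact: is_).
  rewrite (Rintegral_periodic_eq0 rG Rc Rs)//; last by apply: assoc; exact: ic.
  by rewrite (Rintegral_periodic_eq0 jG Ic Is)// ?subrr//; apply: assoc; exact: is_.
- under eq_Rintegral do rewrite Im_mul Re_mul_real Im_mul_real ReE_ek ImE_ek -!mulrA.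
  rewrite RintegralD//; try by apply: assoc; (exact: ic || exact: is_).
  rewrite (Rintegral_periodic_eq0 rG Rc Rs)//; last by apply: assoc; exact: is_.
  by rewrite (Rintegral_periodic_eq0 jG Ic Is)// ?addr0//; apply: assoc; exact: ic.
Qed.

Lemma cLfun2P (g : R -> R[i]) : cmeasurable g ->
  (\int[mu]_x (normc (g x) ^+ 2)%:E < +oo)%E -> cLfun 2 g.
Proof.
move=> [rg jg] gi; split => //; rewrite /finite_norm unlock; apply: poweR_lty.
congr (_ < _)%E: gi; apply: eq_integral => x _.
by rewrite /= ger0_norm ?normc_ge0r// powR_mulrn ?normc_ge0r.
Qed.
End periodic_weights.
(** * The dual system *)

Section dual_functions.
Variables (R : realType) (F : {linear L2 R -> L2 R}) (phi : L2 R).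
Local Notation mu := (@lebesgue_measure R).
Local Notation D := (`[0, 1[%classic : set R).
Hypothesis Phi_int : mu.-integrable D (fun t => (Phi F phi t)^-1)%E.
Local Notation g := (L2_to_fun (F phi)).
Local Notation g2 := (fun x => normc (g x) ^+ 2).
Local Notation p := (periodize g2).

Let g2_ge0 x : 0 <= g2 x. Proof. exact: sqr_ge0. Qed.

Let g2_int : mu.-integrable setT (EFin \o g2).
Proof. exact: integrable_normc_sqr (cLfun_L2 _). Qed.

Let mg2 : measurable_fun setT g2.
Proof. by apply: measurable_funX; apply: measurable_cL2; exact: cLfun_L2. Qed.

Let mp : measurable_fun [set: R] p. Proof. exact: measurable_periodize. Qed.

Let p_ge0 x : 0 <= p x. Proof. exact: periodize_ge0. Qed.

Let mpV : measurable_fun [set: R] (fun x => (p x)^-1).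
Proof.
under eq_fun do rewrite -powR_inv1//.
exact: (measurableT_comp (measurable_powR _) mp).
Qed.

(** An integrable 1 / Phi is finite almost everywhere, which excludes Phi = 0 since the inverse of 0
    is +oo. Phi is itself finite almost everywhere, as the periodization of the integrable |g|^2,
    and there it is [p]. *)
Let ae_Phi : {ae mu, forall t, D t -> p t != 0 /\ ((Phi F phi t)^-1 = (p t)^-1%:E)%E}.
Proof.
have := ae_periodize g2_ge0 g2_int.
have := Phi_int => /integrable_ae => /(_ (measurable_itv _)).
apply: (filterS2 (ae_filter_ringOfSetsType mu)) => t fin per tD.
move: (fin tD); rewrite /Phi per//; have [->|p0] := eqVneq (p t) 0.
  by rewrite inve0.
by rewrite inver (negbTE p0).
Qed.

Let ae_p : {ae mu, forall x, p x != 0}.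
Proof.
apply: (ae_periodic (P := fun x => p x != 0)).
- rewrite (_ : mkset _ = p @^-1` [set~ 0]).
    by rewrite -[X in measurable X]setTI; apply: mp => //; exact: measurableC.
  by apply/seteqP; split => x /=; move/eqP.
- by move=> x k; rewrite periodize_periodic.
- by apply: (filterS (F := almost_everywhere mu)) ae_Phi => t h /h[].
Qed.

Let pV_lty : (\int[mu]_(t in D) (p t)^-1%:E < +oo)%E.
Proof.
have /integrableP[mPhi] := Phi_int; congr (_ < _)%E.
apply: ge0_ae_eq_integral => //.
- exact: measurableT_comp.
- by apply: measurable_funTS; exact/measurable_EFinP.
- by move=> t _; rewrite lee_fin invr_ge0.
- apply: (filterS (F := almost_everywhere mu)) ae_Phi => t h tD.
  by have [_ ->] := h tD; rewrite gee0_abs// lee_fin invr_ge0.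
Qed.

(* Here (p x)^-1 = 0 when p x = 0, that is, when the sum defining Phi is 0 or
   infinite, which happens only on a null set. *)
Definition dual_weight (x : R) : R[i] := (g x)^*%C * ((p x)^-1)%:C.

Lemma cLfun_dual_weight : cLfun 2 dual_weight.
Proof.
have [rg jg _] := cLfun_L2 (F phi).
apply: cLfun2P.
  by apply: cmeasurableM; [exact: cmeasurable_conj|exact: cmeasurable_real].
apply: le_lt_trans pV_lty.
(* In this form 1 / p is the periodization of |g|^2 times the periodic weight 1 / p^2; at p = 0 both
   sides are 0. *)
rewrite [leRHS](_ : _ = \int[mu]_(t in D) (p t * (p t)^-1 ^+ 2)%:E)%E; last first.
  apply: eq_integral => t _; have [->|p0] := eqVneq (p t) 0; first by rewrite invr0 mul0r.
  by rewrite expr2 mulrA divff// mul1r.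
rewrite -ge0_integral_periodize//; last 3 first.
- by move=> x; exact: sqr_ge0.
- exact: measurable_funX.
- by move=> x k; rewrite periodize_periodic.
rewrite le_eqVlt; apply/orP; left; apply/eqP; apply: eq_integral => x _.
by rewrite /dual_weight normcM normc_conj normc_real exprMn ger0_norm ?invr_ge0.
Qed.

Lemma cL2_dual (k : int) : (fun x => dual_weight x * ek (- k) x) \in @cL2pred R.
Proof.
rewrite inE; apply: (@cLfun_le _ _ dual_weight).
- apply: cmeasurableM; last exact: cmeasurable_ek.
  by case: cLfun_dual_weight.
- exact: cLfun_dual_weight.
- by move=> x; rewrite normcM normc_ek mulr1.
Qed.

Definition dual_fun k := CL2fun (cL2_dual k).

Lemma p_div_le1 x : p x * (p x)^-1 <= 1.
Proof. by have [->|p0] := eqVneq (p x) 0; [rewrite mul0r|rewrite divff]. Qed.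

(** The periodization is p / p, at most 1 under the convention 1 / 0 = 0, and a period has length
    1. *)
Let g2p_int : mu.-integrable setT (EFin \o (fun x => g2 x * (p x)^-1)).
Proof.
apply/integrableP; split; first by apply/measurable_EFinP; exact: measurable_funM.
rewrite [ltLHS](_ : _ = \int[mu]_x (g2 x * (p x)^-1)%:E)%E; last first.
  by apply: eq_integral => x _; rewrite /comp/= ger0_norm// mulr_ge0 ?invr_ge0// sqr_ge0.
rewrite ge0_integral_periodize//; last 2 first.
- by move=> x; rewrite invr_ge0.
- by move=> x k; rewrite periodize_periodic.
apply: (@le_lt_trans _ _ (\int[mu]_(t in D) (cst 1 t)))%E.
  apply: ge0_le_integral => //.
  - by move=> x _; rewrite lee_fin mulr_ge0 ?invr_ge0.
  - by apply: measurable_funTS; apply/measurable_EFinP; exact: measurable_funM.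
  - by move=> x _; rewrite lee_fin p_div_le1.
by rewrite integral_cst//= mul1e lebesgue_measure_itv/= lte_fin ltr01 -EFinB ltry.
Qed.

(** Reduces biorthogonality to integrals of cosines and sines over one period; the bound on [e] lets
    |g|^2 / p dominate the integrand. *)
Lemma Rintegral_g2p (e : R -> R) : measurable_fun setT e -> periodic1 e ->
  (forall x, `|e x| <= 1) ->
  \int[mu]_x (g2 x * ((p x)^-1 * e x)) = \int[mu]_(t in D) e t.
Proof.
move=> me e1 ele.
have [|||i <-] := Rintegral_periodize (f := g2)
  (psi := fun x => (p x)^-1 * e x) g2_ge0 g2_int.
- exact: measurable_funM.
- by move=> x k; rewrite periodize_periodic e1.
- have := integrable_mul_le1 measurableT me ele g2p_int.
  by apply: eq_integrable => // x _ /=; rewrite mulrA.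
congr fine; apply: ae_eq_integral => //.
- exact: (measurable_int _ i).
- by apply: measurable_funTS; exact/measurable_EFinP.
- apply: (filterS (F := almost_everywhere mu)) ae_p => t p0 _.
  by rewrite mulrA divff// mul1r.
Qed.
Hypothesis F_fourier : is_fourier_transform F.

Let mg : cmeasurable g. Proof. by have [] := cLfun_L2 (F phi). Qed.

Let mdw : cmeasurable dual_weight. Proof. by have [] := cLfun_dual_weight. Qed.

Lemma mul_conj_normc (z : R[i]) : z * z^*%C = (normc z ^+ 2)%:C.
Proof. by rewrite -sqr_normc normE_normc rmorphXn. Qed.

Lemma ae_fourier_shift j :
  {ae mu, forall x, L2_to_fun (F (shifts phi j)) x = ek j x * g x}.
Proof. by rewrite /shifts fourier_translate//; exact: L2_to_fun_pi. Qed.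

Lemma pairing_shift (w : cL2fun R) j : pairing w (F (shifts phi j)) =
  cintegral (fun x => ek j x * g x * w x).
Proof.
have [rw jw _] := cL2funP w; apply: ae_cintegral.
- by apply: cmeasurableM => //; have [] := cLfun_L2 (F (shifts phi j)).
- by apply: cmeasurableM => //; apply: cmeasurableM => //; exact: cmeasurable_ek.
- by apply: (filterS (F := almost_everywhere mu)) (ae_fourier_shift j) => x ->.
Qed.

Lemma pairing_dual j k : pairing (dual_fun k) (F (shifts phi j)) = (j == k)%:R.
Proof.
rewrite pairing_shift.
(* The conjugate in [dual_weight] meets g and leaves a nonnegative function, to which periodization
   applies. *)
have E x : ek j x * g x * dual_fun k x = (g2 x * (p x)^-1)%:C * ek (j - k) x.
  rewrite /= /dual_weight rmorphM/= -mul_conj_normc ekD; ring.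
under [in LHS]eq_fun do rewrite E.
rewrite -[j == k]subr_eq0.
apply: ReImP; rewrite /cintegral/=.
- transitivity (\int[mu]_x (g2 x * ((p x)^-1 * cosk (j - k) x))).
    by apply: eq_Rintegral => x _; rewrite mul0r subr0 mulrA.
  rewrite (Rintegral_g2p (measurable_cosk _) (cosk_periodic _)) ?Rintegral_cosk.
    by case: eqP.
  by move=> x; exact: cos_max.
- transitivity (\int[mu]_x (g2 x * ((p x)^-1 * sink (j - k) x))).
    by apply: eq_Rintegral => x _; rewrite mul0r addr0 mulrA.
  rewrite (Rintegral_g2p (measurable_sink _) (sink_periodic _)) ?Rintegral_sink.
    by case: eqP.
  by move=> x; exact: sin_max.
Qed.

Lemma cL2_conj (u : L2 R) : (fun x => (L2_to_fun u x)^*%C) \in @cL2pred R.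
Proof.
rewrite inE; have Lu := cLfun_L2 u; apply: (cLfun_le _ Lu).
  by apply: cmeasurable_conj; case: Lu.
by move=> x; rewrite normc_conj.
Qed.

Lemma pairing_conj_shift (u : L2 R) :
  (forall k, pairing (dual_fun k) (F u) = 0) ->
  forall k, pairing (CL2fun (cL2_conj (F u))) (F (shifts phi k)) = 0.
Proof.
move=> u0 k; rewrite pairing_shift.
have Lu := cLfun_L2 (F u); have [ru ju _] := Lu.
have Lg := cLfun_L2 (F phi).
pose q x := L2_to_fun (F u) x * (g x)^*%C.
pose G x := L2_to_fun (F u) x * dual_weight x.
have mq : cmeasurable q by apply: cmeasurableM => //; exact: cmeasurable_conj.
have mG : cmeasurable G by exact: cmeasurableM.
have GE x : G x * (p x)%:C = q x * (p x * (p x)^-1)%:C.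
  by rewrite /G /q /dual_weight rmorphM/=; ring.
have Gi : cintegrable G by apply: cintegrable_mul => //; exact: cLfun_dual_weight.
(* The dual functional of index - m is the one that carries e_m. *)
have Gk m : cintegral (fun x => G x * ek m x) = 0.
  rewrite -(u0 (- m)) /pairing; congr cintegral; apply/funext => x.
  by rewrite /G /= opprK mulrA.
(* The weight p may be unbounded; the product is integrable because G p is q times p / p, dominated
   by |F u| |g|. *)
have Gp : mu.-integrable setT (EFin \o (fun x => normc (G x) * p x)).
  have [i _] := integrable_normcM Lu Lg.
  apply: le_integrable i => //.
    apply/measurable_EFinP; apply: measurable_funM => //.
    by case: mG => *; exact: measurable_normc.
  move=> x _; rewrite /= lee_fin.
  have -> : normc (G x) * p x = normc (G x * (p x)%:C).
    by rewrite [RHS]normcM normc_real ger0_norm.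
  have pp0 : 0 <= p x * (p x)^-1 by rewrite mulr_ge0 ?invr_ge0.
  rewrite GE (normcM (q x)) normc_real (normcM (L2_to_fun (F u) x)) normc_conj.
  have n0 : 0 <= normc (L2_to_fun (F u) x) * normc (g x) by rewrite mulr_ge0 ?normc_ge0r.
  by rewrite normrM normr_id ler_piMr// ger0_norm// p_div_le1.
have pp : periodic1 p by exact: periodize_periodic.
have qk m : cintegral (fun x => q x * ek m x) = 0.
  rewrite -(cintegral_periodic_eq0 Gi Gk mp pp Gp m); apply: ae_cintegral.
  - by apply: cmeasurableM => //; exact: cmeasurable_ek.
  - apply: cmeasurableM; last exact: cmeasurable_ek.
    by apply: cmeasurableM => //; exact: cmeasurable_real.
  - apply: (filterS (F := almost_everywhere mu)) ae_p => x p0.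
    by rewrite GE divff// mulr1.
have qi : cintegrable (fun x => q x * ek (- k) x).
  have [i _] := integrable_normcM Lu Lg.
  apply: cintegrable_le i _; first by apply: cmeasurableM => //; exact: cmeasurable_ek.
  by move=> x; rewrite !normcM normc_conj normc_ek mulr1.
(* The pairing with conj(F u) is the conjugate of the integral of q e_{-k}. *)
rewrite -[RHS]conjc0 -(qk (- k)) -cintegral_conj//; congr cintegral; apply/funext => x.
have ekJ : ((ek (- k) x)^*)%C = ek k x.
  by apply: ReImP; rewrite /= ?intrN ?mulrN ?mulNr ?cosN ?sinN ?opprK.
have conjcM (a b : R[i]) : (a * b)^*%C = a^*%C * b^*%C by exact: rmorphM.
rewrite /q !conjcM ekJ conjcK /=; ring.
Qed.
End dual_functions.

Theorem proposition2 (R : realType) (F : {linear L2 R -> L2 R})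
    (F_fourier : is_fourier_transform F) (phi : L2 R) :
  (@lebesgue_measure R).-integrable `[0, 1[
    (fun t => (Phi F phi t)^-1)%E ->
  M_basis (shift_system phi).
Proof.
move=> Phi_int; have [Fnorm _] := F_fourier.
pose ystar k : {linear shift_span phi -> R[i]^o} :=
  pairing (dual_fun Phi_int k) \o F \o val.
have ystarE k j : ystar k (shift_system phi j) = (j == k)%:R.
  exact: pairing_dual.
have ystar_cont k : continuous (ystar k).
  apply: (le_linear_continuous (C := 2 * cLnorm 2 (dual_fun Phi_int k))) => v.
  by apply: (le_trans (pairing_le _ _)); rewrite Fnorm.
split.
- exact: complete_clspan.
(* A continuous functional vanishing at the other translates vanishes on their closed span, whereas
   [ystar k] is 1 at index k. *)
- move=> k yk; have := linear_closed_span_eq0 (ystar_cont k) _ yk.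
  rewrite ystarE eqxx => /(_ _)/eqP; rewrite oner_eq0 => h; apply: notF; apply: h.
  by move=> _ [j /= jk <-]; have := ystarE k j; rewrite (negbTE jk).
- exists ystar; first by split.
  move=> v v0; set u := val v.
  (* With this weight [l] is the inner product of F x with F u, so l u is the squared norm of F
     u. *)
  pose w := CL2fun (cL2_conj (F u)).
  pose l : {linear L2 R -> R[i]^o} := pairing w \o F.
  have lc : continuous l.
    apply: (le_linear_continuous (C := 2 * cLnorm 2 w)) => x.
    by apply: (le_trans (pairing_le _ _)); rewrite Fnorm.
  (* u lies in the closed span of the translates of phi, on each of which [l] vanishes. *)
  have lu : l u = 0.
    apply: (linear_closed_span_eq0 lc _ (set_mem (valP v))) => _ [k _ <-].
    exact: (@pairing_conj_shift _ _ _ Phi_int F_fourier u v0 k).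
  apply: val_inj; apply/normr0_eq0; rewrite -Fnorm.
  rewrite L2_normE; suff -> : cLnorm 2 (L2_to_fun (F u)) = 0 by [].
  apply/eqP; rewrite -sqrf_eq0; apply/eqP.
  transitivity (Re (l u)); last by rewrite lu.
  rewrite /l /= -[LHS]/(fine (_ ^+ 2)%:E) cLnorm_sqr; last exact: cLfun_L2.
  apply: eq_Rintegral => x _.
  by rewrite -[RHS]/(Re (L2_to_fun (F u) x * (L2_to_fun (F u) x)^*%C)) mul_conj_normc.
Qed.
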